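(* Let $F=F(X)$ be a free group of finite rank at least $2$ with free basis $X$, and let $N\unlhd F$ be a recursively enumerable normal subgroup. If the conjugacy problem $\mathrm{CP}(F/N')$ is decidable, then the power problem $\mathrm{PP}(F/N)$ is decidable.
   Context: $N'=[N,N]$ is the derived subgroup of $N$. Groups $F/N$ and $F/N'$ are considered with the generating set $X$; inputs are words over $X\cup X^{-1}$. $\mathrm{PP}(G)$: given words $u,v$ in the generators of $G$, decide whether $v=u^k$ in $G$ for some $k\in\mathbb Z$. $\mathrm{CP}(G)$: given words $u,v$ in the generators of $G$, decide whether $u$ and $v$ are conjugate in $G$. *)

(* Defs.v *)
From HB Require Import structures.
From mathcomp Require Import all_boot ssralg ssrint.
From mathcomp Require Import boolp classical_sets.

Set Implicit Arguments.
Unset Strict Implicit.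
Unset Printing Implicit Defensive.

Local Open Scope quotient_scope.
Local Open Scope group_scope.
Local Open Scope classical_set_scope.

(* The total recursive functions on the natural numbers: the least class with
   zero, successor and projections, closed under composition, primitive
   recursion and minimization of regular functions (those for which a least
   zero exists at every argument).  Every constructor describes its function
   pointwise, so that the class is closed under extensional equality. *)
Inductive recursive : forall k : nat, (k.-tuple nat -> nat) -> Prop :=
| recursive_zero k (F : k.-tuple nat -> nat) of
    (forall x, F x = 0) : recursive F
| recursive_succ (F : 1.-tuple nat -> nat) of
    (forall x, F x = (tnth x ord0).+1) : recursive F
| recursive_proj k (i : 'I_k) (F : k.-tuple nat -> nat) of
    (forall x, F x = tnth x i) : recursive F
| recursive_comp k m (f : m.-tuple nat -> nat) (g : 'I_m -> k.-tuple nat -> nat)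
    (F : k.-tuple nat -> nat) of
    recursive f & (forall i, recursive (g i)) &
    (forall x, F x = f [tuple g i x | i < m]) : recursive F
| recursive_prec k (g : k.-tuple nat -> nat) (h : k.+2.-tuple nat -> nat)
    (F : k.+1.-tuple nat -> nat) of
    recursive g & recursive h &
    (forall x : k.-tuple nat, F [tuple of 0 :: x] = g x) &
    (forall n (x : k.-tuple nat),
       F [tuple of n.+1 :: x] = h [tuple of n :: F [tuple of n :: x] :: x]) :
    recursive F
| recursive_min k (f : k.+1.-tuple nat -> nat) (F : k.-tuple nat -> nat) of
    recursive f &
    (forall x : k.-tuple nat, f [tuple of F x :: x] = 0) &
    (forall (x : k.-tuple nat) m, (m < F x)%N -> f [tuple of m :: x] <> 0) :
    recursive F.

Definition rec_enumerable (S : set nat) : Prop :=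
  S = set0 \/
  exists f : 1.-tuple nat -> nat,
    recursive f /\ S = range (fun i : nat => f [tuple i]).

(* (x, false) stands for x and (x, true) for x^-1. *)
Definition letter (X : Type) : Type := (X * bool)%type.
Definition word (X : Type) : Type := seq (letter X).

Definition eval_letter (X : Type) (G : groupType) (f : X -> G)
    (a : letter X) : G :=
  if a.2 then (f a.1)^-1 else f a.1.

Definition eval (X : Type) (G : groupType) (f : X -> G) (w : word X) : G :=
  \prod_(a <- w) eval_letter f a.

Section Coding.
Variable X : finType.

(* Bijective numeration in base 2 * #|X|. *)
Definition letter_code (a : letter X) : nat := (a.2 + (enum_rank a.1).*2)%N.

Definition word_code (w : word X) : nat :=
  foldr (fun a m => (letter_code a + #|X|.*2 * m).+1) 0%N w.

Definition rec_enumerable_lang (L : set (word X)) : Prop :=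
  rec_enumerable (word_code @` L).

Definition decidable_rel (P : word X -> word X -> Prop) : Prop :=
  exists f : 2.-tuple nat -> nat,
    recursive f /\
    forall u v : word X,
      (P u v -> f [tuple word_code u; word_code v] = 1%N) /\
      (~ P u v -> f [tuple word_code u; word_code v] = 0%N).

End Coding.

Section FreeGroup.
Variable X : choiceType.
Implicit Types (a : letter X) (u v w : seq (X * bool)).

Definition inv_letter a : X * bool := (a.1, ~~ a.2).

Lemma inv_letterK : involutive inv_letter.
Proof. by case=> x b; rewrite /inv_letter /= negbK. Qed.

Definition reduced w : bool := sorted (fun a b => b != inv_letter a) w.

(* Left multiplication of a reduced word by a letter. *)
Definition push a w : seq (X * bool) :=
  if w is b :: w' then (if b == inv_letter a then w' else a :: w) else [:: a].

Lemma reduced_push a w : reduced w -> reduced (push a w).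
Proof.
case: w => //= b w red; case: eqP => [_|/eqP ne] /=.
  by case: w red => //= c w /andP[].
by rewrite ne.
Qed.

Lemma push_invK a w : reduced w -> push (inv_letter a) (push a w) = w.
Proof.
case: w => [|b w] /= red; first by rewrite inv_letterK eqxx.
case: (eqVneq b (inv_letter a)) red => [->|ne] red /=; last first.
  by rewrite inv_letterK eqxx.
case: w red => //= c w /andP[/negbTE -> _].
by [].
Qed.

Definition mul_word u v := foldr push v u.

Lemma reduced_mul u v : reduced v -> reduced (mul_word u v).
Proof. by move=> red; elim: u => //= a u; apply: reduced_push. Qed.

Lemma mul_push a u v :
  reduced u -> reduced v -> mul_word (push a u) v = push a (mul_word u v).
Proof.
case: u => [|b u] //= _ red; case: eqP => //= ->.
have := @push_invK (inv_letter a) (mul_word u v) (reduced_mul u red).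
by rewrite inv_letterK => ->.
Qed.

Lemma mul_wordA u v w :
  reduced v -> reduced w -> mul_word u (mul_word v w) = mul_word (mul_word u v) w.
Proof.
by move=> rv rw; elim: u => //= a u ->; rewrite mul_push ?reduced_mul.
Qed.

Lemma mul_word_nil w : reduced w -> mul_word w [::] = w.
Proof.
elim: w => //= a w IH red.
have rw : reduced w by case: w {IH} red => //= b w /andP[].
by rewrite IH //; case: w red {rw IH} => //= b w /andP[/negbTE -> _].
Qed.

Definition inv_word w := rev (map inv_letter w).

Lemma reduced_inv w : reduced w -> reduced (inv_word w).
Proof.
rewrite /reduced /inv_word rev_sorted sorted_map.
apply: sub_sorted => a b /= ne.
apply: contra ne => /eqP E; apply/eqP.
by rewrite E inv_letterK.
Qed.

Lemma mul_inv_word w : reduced w -> mul_word (inv_word w) w = [::].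
Proof.
elim: w => //= a w IH red.
have rw : reduced w by case: w {IH} red => //= b w /andP[].
rewrite /inv_word /= rev_cons -cats1 /mul_word foldr_cat /= inv_letterK eqxx.
exact: IH.
Qed.

Record free_group : Type := FreeGroup {
  free_word : seq (X * bool);
  _ : reduced free_word }.

HB.instance Definition _ := [isSub for free_word].
HB.instance Definition _ := [Choice of free_group by <:].

Lemma free_wordP (g : free_group) : reduced (free_word g).
Proof. exact: valP. Qed.

Definition free_one : free_group := @FreeGroup [::] isT.
Definition free_mul (g h : free_group) : free_group :=
  FreeGroup (reduced_mul (free_word g) (free_wordP h)).
Definition free_inv (g : free_group) : free_group :=
  FreeGroup (reduced_inv (free_wordP g)).

Fact free_mulA : associative free_mul.
Proof. by move=> g h k; apply/val_inj/mul_wordA; apply: free_wordP. Qed.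
Fact free_mul1g : left_id free_one free_mul.
Proof. by move=> g; apply/val_inj. Qed.
Fact free_mulg1 : right_id free_one free_mul.
Proof. by move=> g; apply/val_inj/mul_word_nil/free_wordP. Qed.
Fact free_mulVg : left_inverse free_one free_inv free_mul.
Proof. by move=> g; apply/val_inj/mul_inv_word/free_wordP. Qed.
Fact free_mulgV : right_inverse free_one free_inv free_mul.
Proof.
move=> g; rewrite -[LHS]free_mul1g -(free_mulVg (free_inv g)) -free_mulA.
by rewrite [free_mul (free_inv g) _]free_mulA free_mulVg free_mul1g.
Qed.

HB.instance Definition _ := isGroup.Build free_group
  free_mulA free_mul1g free_mulg1 free_mulVg free_mulgV.

Definition free_gen (x : X) : free_group := @FreeGroup [:: (x, false)] isT.

Lemma eval_free_gen w : free_word (eval free_gen w) = mul_word w [::].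
Proof.
rewrite /eval; elim: w => [|[x b] w IH]; first by rewrite big_nil.
by rewrite big_cons -[mul_word _ _]/(push (x, b) (mul_word w [::])) -IH; case: b.
Qed.

Lemma eval_free_word (g : free_group) : eval free_gen (free_word g) = g.
Proof. by apply/val_inj; rewrite /= eval_free_gen mul_word_nil ?free_wordP. Qed.

End FreeGroup.

Definition subgroup (G : groupType) (H : set G) : Prop :=
  [/\ H 1, forall x y, H x -> H y -> H (x * y) & forall x, H x -> H x^-1].

Record normal_subgroup (G : groupType) : Type := NormalSubgroup {
  normal_set :> set G;
  normal_subgroupP : subgroup normal_set;
  normal_conj : forall x g, normal_set x -> normal_set (x ^ g) }.

Section Derived.
Variables (G : groupType) (N : normal_subgroup G).

Definition derived_set : set G :=
  smallest (@subgroup G) [set [~ x, y] | x in N & y in N].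

Fact derived_subgroup : subgroup derived_set.
Proof.
split=> [H [[H1 _ _] _]|x y Hx Hy H HP|x Hx H HP] //; have [[_ HM HV] _] := HP.
  by apply: HM; [apply: Hx|apply: Hy].
by apply: HV; apply: Hx.
Qed.

Fact derived_conj x g : derived_set x -> derived_set (x ^ g).
Proof.
move=> Dx H [[H1 HM HV] Hcomm]; apply: (Dx [set y | H (y ^ g)]).
split; first split=> [|y z|y] /=.
- by rewrite conj1g.
- by rewrite conjMg; apply: HM.
- by rewrite conjVg; apply: HV.
move=> _ [y Ny] [z Nz] <- /=; rewrite conjRg; apply: Hcomm.
by exists (y ^ g); [exact: normal_conj|exists (z ^ g); [exact: normal_conj|]].
Qed.

Definition derived : normal_subgroup G :=
  NormalSubgroup derived_subgroup derived_conj.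

End Derived.

Section Quotient.
Variables (G : groupType) (N : normal_subgroup G).

Definition coset_rel : rel G := fun x y => `[< normal_set N (x^-1 * y) >].

Fact coset_rel_equiv : equiv_class_of coset_rel.
Proof.
have [N1 NM NV] := normal_subgroupP N; split=> [x|x y|y x z].
- by apply/asboolP; rewrite mulVg.
- by apply/asboolP/asboolP => /NV; rewrite invgM invgK.
move=> /asboolP Nxy /asboolP Nyz; apply/asboolP.
by have := NM _ _ Nxy Nyz; rewrite mulgA mulgK.
Qed.

Canonical coset_equiv := EquivRelPack coset_rel_equiv.

Definition quotient : Type := {eq_quot coset_equiv}.
HB.instance Definition _ := Choice.on quotient.
HB.instance Definition _ := EqQuotient.on quotient.

Definition coset (x : G) : quotient := \pi_quotient x.

Lemma cosetP x y : coset x = coset y <-> normal_set N (x^-1 * y).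
Proof. by split=> [/eqmodP/asboolP|Nxy]; [|apply/eqmodP/asboolP]. Qed.

Lemma coset_surj (q : quotient) : exists x, coset x = q.
Proof. by exists (repr q); apply: reprK. Qed.

Definition quotient_one : quotient := coset 1.
Definition quotient_mul (p q : quotient) : quotient := coset (repr p * repr q).
Definition quotient_inv (p : quotient) : quotient := coset (repr p)^-1.

Lemma coset_repr x : normal_set N ((repr (coset x))^-1 * x).
Proof. by apply/cosetP; apply: reprK. Qed.

Lemma quotient_mulE x y : quotient_mul (coset x) (coset y) = coset (x * y).
Proof.
have [_ NM _] := normal_subgroupP N; apply/cosetP.
set a := repr _; set b := repr _.
have -> : (a * b)^-1 * (x * y) = (a^-1 * x) ^ b * (b^-1 * y).
  by rewrite /conjg invgM !mulgA mulgK.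
by apply: NM; [apply: normal_conj|]; apply: coset_repr.
Qed.

Lemma quotient_invE x : quotient_inv (coset x) = coset x^-1.
Proof.
have [_ _ NV] := normal_subgroupP N; apply/cosetP.
set a := repr _.
have -> : a^-1^-1 * x^-1 = (a^-1 * x)^-1 ^ a^-1.
  by rewrite /conjg !invgM !invgK !mulgA mulgK.
by apply/normal_conj/NV/coset_repr.
Qed.

Fact quotient_mulA : associative quotient_mul.
Proof.
move=> p q r; have [x <-] := coset_surj p.
have [y <-] := coset_surj q; have [z <-] := coset_surj r.
by rewrite !quotient_mulE mulgA.
Qed.
Fact quotient_mul1g : left_id quotient_one quotient_mul.
Proof. by move=> p; have [x <-] := coset_surj p; rewrite quotient_mulE mul1g. Qed.
Fact quotient_mulg1 : right_id quotient_one quotient_mul.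
Proof. by move=> p; have [x <-] := coset_surj p; rewrite quotient_mulE mulg1. Qed.
Fact quotient_mulVg : left_inverse quotient_one quotient_inv quotient_mul.
Proof.
move=> p; have [x <-] := coset_surj p.
by rewrite quotient_invE quotient_mulE mulVg.
Qed.
Fact quotient_mulgV : right_inverse quotient_one quotient_inv quotient_mul.
Proof.
move=> p; have [x <-] := coset_surj p.
by rewrite quotient_invE quotient_mulE mulgV.
Qed.

HB.instance Definition _ := isGroup.Build quotient
  quotient_mulA quotient_mul1g quotient_mulg1 quotient_mulVg quotient_mulgV.

End Quotient.

Definition intexp (G : groupType) (x : G) (k : int) : G :=
  match k with Posz n => x ^+ n | Negz n => x ^- n.+1 end.

Section Problems.
Variables (X : finType) (G : groupType) (gen : X -> G).

Definition power_problem_decidable : Prop :=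
  @decidable_rel X (fun u v => exists k : int, eval gen v = intexp (eval gen u) k).

Definition conjugacy_problem_decidable : Prop :=
  @decidable_rel X (fun u v => exists g : G, eval gen v = eval gen u ^ g).

End Problems.

Definition quotient_gen (X : choiceType) (N : normal_subgroup (free_group X))
    (x : X) : quotient N := coset N (free_gen x).

(* A set of elements of the free group is recursively enumerable when the set
   of all words, reduced or not, that represent its elements is. *)
Definition rec_enumerable_subset (X : finType) (S : set (free_group X)) : Prop :=
  rec_enumerable_lang [set w : word X | S (eval (@free_gen X) w)].

(* Main.v *)
Require Import Defs.
From mathcomp Require Import all_boot ssralg ssrint zify.
From mathcomp Require Import boolp classical_sets.

(* Since N is recursively enumerable, "v is a power of u in F/N" is
   semi-decidable; the conjugacy test in F/N' is used to semi-decide the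
   opposite, by searching for certificates. Put U = <u>N.

   If v is in U, then for n, m in N the elements u n m and u n m^v are conjugate
   in F/N', because N/N' is abelian and conjugating u n m by m^-1 replaces m by
   m^u. Conversely, suppose that v commutes with u modulo N but is not in U. A
   word has a flow on the Schreier graph of U (the signed number of times it
   crosses each edge), which on U is a homomorphism killing N'. Elements that
   commute with u modulo N act on this graph, and by freeness one finds, for
   every such v outside U, an m in N whose flow v does not preserve: a commutator
   of two loops in a quotient graph, one of which crosses an edge exactly once
   and the other never. Combining such elements with large exponents gives an n
   whose flow is preserved by U only; then u n^K m and u n^K m^v are not
   conjugate in F/N' when K is large. If v does not commute with u modulo N,
   the same construction applied to N in place of U yields an m in N that the
   commutator of u and v does not centralize in F/N'. This needs N <> 1; when
   N = 1 flows give the bound |k| <= 2 |v| for v = u^k, and equality in F is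
   decided by the conjugacy test. *)

(** * Recursive functions and semi-decidable relations *)

Set Implicit Arguments.
Unset Strict Implicit.
Unset Printing Implicit Defensive.

(** Working with functions on lists keeps tuple lengths out of the later arguments; only the values
    on lists of length [k] count. *)
Definition rec (k : nat) (f : seq nat -> nat) : Prop :=
  recursive (fun x : k.-tuple nat => f x).

Lemma rec_comp k m f (g : nat -> seq nat -> nat) :
  rec m f -> (forall i, i < m -> rec k (g i)) ->
  rec k (fun s => f (mkseq (g^~ s) m)).
Proof.
move=> rf rg; apply: (@recursive_comp k m _ (fun i x => g i x) _ rf).
  by move=> i; apply: rg.
move=> x; congr (f _); rewrite /mkseq -val_enum_ord -map_comp.
by apply: eq_map => i.
Qed.

Lemma rec_eq k f g : (forall s, size s = k -> f s = g s) -> rec k f -> rec k g.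
Proof.
move=> fg rf; apply: (@recursive_comp k k _ (fun i x => tnth x i) _ rf).
  by move=> i; apply: (@recursive_proj k i).
move=> x; rewrite -fg ?size_tuple //; congr (f (tval _)).
by apply: eq_from_tnth => i; rewrite tnth_mktuple.
Qed.

Lemma rec_nth k i : i < k -> rec k (fun s => nth 0 s i).
Proof.
by move=> ik; apply: (@recursive_proj k (Ordinal ik)) => x; rewrite (tnth_nth 0).
Qed.

Lemma rec0 k : rec k (fun=> 0).
Proof. exact: recursive_zero. Qed.

Lemma rec_app1 k (h : nat -> nat) g :
  rec 1 (fun s => h (nth 0 s 0)) -> rec k g -> rec k (fun s => h (g s)).
Proof.
by move=> rh rg; have /= := @rec_comp k 1 _ (fun=> g) rh (fun _ _ => rg).
Qed.

Lemma rec_app2 k (h : nat -> nat -> nat) g1 g2 :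
  rec 2 (fun s => h (nth 0 s 0) (nth 0 s 1)) -> rec k g1 -> rec k g2 ->
  rec k (fun s => h (g1 s) (g2 s)).
Proof.
move=> rh r1 r2.
(* The default [g2] of [nth] serves as the entry at index 1. *)
by have /= := @rec_comp k 2 _ (nth g2 [:: g1]) rh; apply => -[|[|]].
Qed.

Lemma recS k g : rec k g -> rec k (fun s => (g s).+1).
Proof.
by apply: (@rec_app1 k S); apply: recursive_succ => x; rewrite (tnth_nth 0).
Qed.

Lemma rec_const k c : rec k (fun=> c).
Proof. by elim: c => [|c IH]; [exact: rec0|exact: recS]. Qed.

Lemma rec_prec k g h F : rec k g -> rec k.+2 h ->
  (forall x, size x = k -> F (0 :: x) = g x) ->
  (forall n x, size x = k -> F (n.+1 :: x) = h [:: n, F (n :: x) & x]) ->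
  rec k.+1 F.
Proof.
move=> rg rh F0 FS; apply: (recursive_prec rg rh) => [x|n x] /=.
  by rewrite F0 ?size_tuple.
by rewrite FS ?size_tuple.
Qed.

Lemma rec_min k f F : rec k.+1 f ->
  (forall x, size x = k -> f (F x :: x) = 0) ->
  (forall x m, size x = k -> m < F x -> f (m :: x) <> 0) -> rec k F.
Proof.
move=> rf F0 Fm; apply: (recursive_min rf) => [x|x m mF] /=.
  by apply: F0; rewrite size_tuple.
by apply: Fm; rewrite ?size_tuple.
Qed.

Lemma rec_iter2 (g : nat -> nat) (h : nat -> nat -> nat -> nat) F :
  rec 1 (fun s => g (nth 0 s 0)) ->
  rec 3 (fun s => h (nth 0 s 0) (nth 0 s 1) (nth 0 s 2)) ->
  (forall y, F 0 y = g y) -> (forall n y, F n.+1 y = h n (F n y) y) ->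
  rec 2 (fun s => F (nth 0 s 0) (nth 0 s 1)).
Proof.
move=> rg rh F0 FS; apply: rec_prec rg rh _ _ => [x _|n x _] /=.
  exact: F0.
exact: FS.
Qed.

Lemma rec_nat1 (g : nat) (h : nat -> nat -> nat) F :
  rec 2 (fun s => h (nth 0 s 0) (nth 0 s 1)) ->
  F 0 = g -> (forall n, F n.+1 = h n (F n)) ->
  rec 1 (fun s => F (nth 0 s 0)).
Proof.
move=> rh F0 FS; apply: rec_prec (rec_const 0 g) rh _ _ => [x _|n x _] /=.
  exact: F0.
exact: FS.
Qed.

Lemma rec_pred k g : rec k g -> rec k (fun s => (g s).-1).
Proof.
by apply: (@rec_app1 k predn); apply: (@rec_nat1 0 (fun n _ => n)) => //; apply: rec_nth.
Qed.

Lemma rec_add k g1 g2 : rec k g1 -> rec k g2 -> rec k (fun s => g1 s + g2 s).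
Proof.
move=> r1 r2; apply: (@rec_app2 k addn) r1 r2; apply: (@rec_iter2 id (fun _ r _ => r.+1)) => //.
  exact: rec_nth.
by apply: recS; apply: rec_nth.
Qed.

Lemma rec_sub k g1 g2 : rec k g1 -> rec k g2 -> rec k (fun s => g1 s - g2 s).
Proof.
move=> r1 r2; apply: (@rec_app2 k (fun a b => b - a) g2 g1) => //.
apply: (@rec_iter2 id (fun _ r _ => r.-1) (fun a b => b - a)).
- exact: rec_nth.
- by apply: rec_pred; apply: rec_nth.
- by move=> y; rewrite subn0.
- by move=> n y; rewrite subnS.
Qed.

Lemma rec_mul k g1 g2 : rec k g1 -> rec k g2 -> rec k (fun s => g1 s * g2 s).
Proof.
move=> r1 r2; apply: (@rec_app2 k muln) r1 r2; apply: (@rec_iter2 (fun=> 0) (fun _ r y => y + r)).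
- exact: rec0.
- by apply: rec_add; apply: rec_nth.
- by [].
- by move=> n y; rewrite mulSn.
Qed.

Lemma rec_expc k c g : rec k g -> rec k (fun s => c ^ g s).
Proof.
apply: (@rec_app1 k (expn c)); apply: (@rec_nat1 1 (fun _ r => c * r)) => //.
  by apply: rec_mul; [exact: rec_const|exact: rec_nth].
by move=> n; rewrite expnS.
Qed.

(** With this zero test, a conjunction of equations between codes becomes the vanishing of a single
    sum. *)
Definition dist (m n : nat) : nat := (m - n) + (n - m).

Lemma dist_eq0 m n : (dist m n = 0) <-> m = n.
Proof. by rewrite /dist; lia. Qed.

Lemma rec_dist k g1 g2 : rec k g1 -> rec k g2 -> rec k (fun s => dist (g1 s) (g2 s)).
Proof. by move=> r1 r2; apply: rec_add; apply: rec_sub. Qed.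

Lemma mkseq_eq (h : nat -> nat) n s :
  size s = n -> (forall i, i < n -> h i = nth 0 s i) -> mkseq h n = s.
Proof.
move=> sn hs; apply: (@eq_from_nth _ 0); rewrite size_mkseq // => i ik.
by rewrite nth_mkseq // hs.
Qed.

Lemma rec_shift k f g : rec k.+1 f -> rec k g -> rec k (fun x => f (g x :: x)).
Proof.
move=> rf rg.
pose h i := if i is j.+1 then fun s : seq nat => nth 0 s j else g.
have rh i : i < k.+1 -> rec k (h i) by case: i => [_|i ik] /=; [exact: rg|exact: rec_nth].
apply: rec_eq (rec_comp rf rh) => x sx; congr (f _).
by apply: mkseq_eq => [|[|i]] //=; rewrite sx.
Qed.

Lemma rec_swap k f : rec k.+2 f -> rec k.+2 (fun s => f [:: nth 0 s 1, nth 0 s 0 & drop 2 s]).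
Proof.
move=> rf.
pose h i := fun s : seq nat => nth 0 s (if i == 0 then 1 else if i == 1 then 0 else i).
have rh i : i < k.+2 -> rec k.+2 (h i).
  by case: i => [|[|i]] ik; apply: rec_nth.
apply: rec_eq (rec_comp rf rh) => -[|a [|b x]] //= [sx]; congr (f _).
by rewrite drop0; apply: (@mkseq_eq _ k.+2) => [|[|[|i]]] //=; rewrite sx.
Qed.

Lemma rec_drop1 k f : rec k f -> rec k.+1 (fun s => f (behead s)).
Proof.
move=> rf.
have rh i : i < k -> rec k.+1 (fun s => nth 0 s i.+1) by move=> ik; apply: rec_nth.
apply: rec_eq (rec_comp rf rh) => -[|a x] //= [sx]; congr (f _).
exact: mkseq_eq.
Qed.

(** Bounded search as arithmetic: a finite product vanishes exactly when one of its factors does. *)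
Lemma rec_bprod k f g : rec k.+1 f -> rec k g ->
  rec k (fun x => \prod_(i < g x) f (val i :: x)).
Proof.
move=> rf rg.
pose F (s : seq nat) := \prod_(i < head 0 s) f (val i :: behead s).
suff rF : rec k.+1 F by apply: rec_shift rF rg.
pose h (s : seq nat) := nth 0 s 1 * f (nth 0 s 0 :: drop 2 s).
apply: (@rec_prec k (fun=> 1) h) => [|||n x sx].
- exact: rec_const.
- apply: rec_mul; first exact: rec_nth.
  apply: rec_eq (rec_swap (rec_drop1 rf)) => -[|a [|b x]] //.
- by move=> x _; rewrite /F big_ord0.
- by rewrite /F /h /= big_ord_recr /= drop0.
Qed.

Definition semidec (k : nat) (P : seq nat -> Prop) : Prop :=
  exists2 f, rec k.+1 f & forall x, size x = k -> (P x <-> exists t, f (t :: x) = 0).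

Lemma semidec_iff k P Q : (forall x, size x = k -> (P x <-> Q x)) ->
  semidec k P -> semidec k Q.
Proof.
move=> PQ [f rf fP]; exists f => // x sx; rewrite -fP //.
by split=> /(PQ x sx).
Qed.

Lemma semidec_eq0 k f : rec k f -> semidec k (fun x => f x = 0).
Proof.
move=> rf; exists (fun s => f (behead s)); first exact: rec_drop1.
by move=> x _; split=> [|[]] //; exists 0.
Qed.

Lemma prod_eq0 n (F : 'I_n -> nat) :
  \prod_(i < n) F i = 0 <-> exists i, F i = 0.
Proof.
split=> [/eqP|[i Fi]]; last by rewrite (bigD1 i) //= Fi.
by rewrite -[_ == 0]negbK -lt0n => H; apply: contrapT => nF; case/negP: H;
  rewrite prodn_gt0 // => i; rewrite lt0n; apply/eqP => Fi; apply: nF; exists i.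
Qed.

(** One number bounds both the witness [t] and the stage [r] at which it is confirmed, so the double
    search becomes a product over a growing square. *)
Lemma semidec_ex k P :
  semidec k.+1 P -> semidec k (fun x => exists t, P (t :: x)).
Proof.
case=> f rf fP.
exists (fun s => \prod_(t < nth 0 s 0) \prod_(r < nth 0 s 0) f [:: val r, val t & behead s]).
  pose g1 (s : seq nat) :=
    f [:: nth 0 s 0, nth 0 s 1 & behead (behead (behead s))].
  have r1 : rec k.+3 g1.
    have rh i : i < k.+2 ->
        rec k.+3 (fun s => nth 0 s (if i is j.+2 then j.+3 else i)).
      by case: i => [|[|i]] ik; apply: rec_nth.
    apply: rec_eq (rec_comp rf rh) => -[|a [|b [|c x]]] //= [sx]; congr (f _).
    by apply: (@mkseq_eq _ k.+2) => [|[|[|i]]] //=; rewrite sx.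
  have r2 : rec k.+2 (fun s => \prod_(r < nth 0 s 1) g1 (val r :: s)).
    by apply: rec_bprod => //; apply: rec_nth.
  by have := rec_bprod r2 (@rec_nth k.+1 0 isT).
move=> x sx; split=> [[t /fP]|[b /=]].
  rewrite /= sx => /(_ erefl)[r f0]; exists (maxn t r).+1 => /=.
  apply/prod_eq0; have tb : t < (maxn t r).+1 by rewrite ltnS leq_maxl.
  exists (Ordinal tb); apply/prod_eq0.
  have rb : r < (maxn t r).+1 by rewrite ltnS leq_maxr.
  by exists (Ordinal rb).
case/prod_eq0=> t /prod_eq0[r f0]; exists t; apply/fP; first by rewrite /= sx.
by exists r.
Qed.

Lemma semidec_or k P Q : semidec k P -> semidec k Q ->
  semidec k (fun x => P x \/ Q x).
Proof.
case=> f rf fP [g rg gQ]; exists (fun s => f s * g s); first exact: rec_mul.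
move=> x sx; rewrite fP // gQ //; split=> [[[t ft]|[t gt]]|[t]].
- by exists t; rewrite ft.
- by exists t; rewrite gt muln0.
by move/eqP; rewrite muln_eq0 => /orP[]/eqP; [left|right]; exists t.
Qed.

(** Post's theorem: wait for the first stage at which one of the two semi-decisions succeeds, then
    see which one did. *)
Lemma semidec_decides k P : semidec k P -> semidec k (fun x => ~ P x) ->
  exists2 f, rec k f & forall x, size x = k ->
    (P x -> f x = 1) /\ (~ P x -> f x = 0).
Proof.
case=> f rf fP [g rg gP].
(* [ex_minn] needs a witness for every list, hence the guard on the length. *)
have ex x : exists t, (size x == k) ==> (f (t :: x) * g (t :: x) == 0).
  case: eqP => [sx|_]; last by exists 0.
  case: (pselect (P x)) => [/(fP x sx)|/(gP x sx)] [t ft]; exists t.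
    by rewrite ft.
  by rewrite ft muln0.
pose F x := ex_minn (ex x).
have rF : rec k F.
  apply: (@rec_min k (fun s => f s * g s)); first exact: rec_mul.
    by move=> x sx; rewrite /F; case: ex_minnP => t /[!sx] /[!eqxx] /eqP.
  move=> x m sx; rewrite /F; case: ex_minnP => t _ tmin mt /eqP f0.
  by have := tmin m; rewrite sx eqxx f0 leqNgt mt => /(_ isT).
exists (fun x => 1 - f (F x :: x)).
  by apply: rec_sub; [exact: rec_const|exact: rec_shift].
move=> x sx; have : f (F x :: x) * g (F x :: x) = 0.
  by rewrite /F; case: ex_minnP => t /[!sx] /[!eqxx] /eqP.
move/eqP; rewrite muln_eq0 => f0; split=> Px.
  have [/eqP -> //|/eqP g0] := orP f0.
  by have /(gP x sx) : exists t, g (t :: x) = 0 by exists (F x).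
case: eqP f0 => [f0 _|f0 _].
  by case: Px; apply/(fP x sx); exists (F x).
by apply/eqP; rewrite subn_eq0 lt0n; apply/eqP.
Qed.

(** * Codes of words *)

Section WordCode.
Variable X : finType.
Local Notation B := (#|X|.*2).
Local Notation wcode := (@word_code X).

Lemma letter_code_lt (a : letter X) : letter_code a < B.
Proof.
have lt : (enum_rank a.1).+1.*2 <= B by rewrite leq_double; apply: ltn_ord.
by apply: leq_trans lt; rewrite doubleS /letter_code !ltnS -add1n leq_add2r; case: a.2.
Qed.

Lemma letter_code_inj : injective (@letter_code X).
Proof.
move=> [x b] [y c]; rewrite /letter_code /= => E.
have bc : b = c by have := congr1 odd E; rewrite !oddD !odd_double !addbF; case: b c {E} => [] [].
by congr (_, _) => //; apply/enum_rank_inj/val_inj => /=; subst c; lia.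
Qed.

Lemma word_code_inj : injective wcode.
Proof.
elim=> [|a u IH] [|b v] //= [E].
have Bgt0 := leq_ltn_trans (leq0n _) (letter_code_lt a).
have E2 : wcode u * B + letter_code a = wcode v * B + letter_code b.
  by rewrite ![_ * B]mulnC ![B * _ + _]addnC.
have := congr1 (divn^~ B) E2; have := congr1 (modn^~ B) E2 => /=.
rewrite !divnMDl // !modnMDl !modn_small ?divn_small ?letter_code_lt //.
by rewrite !addn0 => /letter_code_inj-> /IH->.
Qed.

Hypothesis X_gt0 : 0 < #|X|.

Lemma letter_code_surj m : m < B -> exists a : letter X, letter_code a = m.
Proof.
move=> mB; have hm : m./2 < #|X| by lia.
exists (enum_val (Ordinal hm), odd m).
by rewrite /letter_code /= enum_valK /= odd_double_half.
Qed.

Lemma word_code_surj m : exists w, wcode w = m.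
Proof.
have B_gt0 : 0 < B by lia.
elim/ltn_ind: m => -[|m] IH; first by exists [::].
have [|w wE] := IH (m %/ B); first by rewrite ltnS leq_div.
have [a aE] := letter_code_surj (ltn_pmod m B_gt0).
by exists (a :: w); rewrite /= wE aE addnC mulnC -divn_eq.
Qed.

Definition word_decode m : word X := projT1 (cid (word_code_surj m)).

Lemma word_decodeK m : wcode (word_decode m) = m.
Proof. by rewrite /word_decode; case: cid. Qed.

Lemma word_codeK w : word_decode (wcode w) = w.
Proof. by apply: word_code_inj; rewrite word_decodeK. Qed.

Lemma size_le_word_code w : size w <= wcode w.
Proof.
elim: w => //= a w IH; have B_gt0 := leq_ltn_trans (leq0n _) (letter_code_lt a).
rewrite ltnS (leq_trans IH) // (leq_trans (leq_pmull _ B_gt0)) //.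
exact: leq_addl.
Qed.

Lemma word_code_cat u v : wcode (u ++ v) = wcode u + B ^ size u * wcode v.
Proof.
elim: u => [|a u IH] /=; first by rewrite mul1n.
by rewrite IH mulnDr expnS addSn !addnA !mulnA.
Qed.

Definition catc m n := wcode (word_decode m ++ word_decode n).

Lemma catcE u v : catc (wcode u) (wcode v) = wcode (u ++ v).
Proof. by rewrite /catc !word_codeK. Qed.

(** This is 1 + B + ... + B^(l-1), the number of words shorter than [l] and hence the least code of
    a word of length [l]. *)
Fixpoint geometric l := if l is l'.+1 then (B * geometric l').+1 else 0.

Lemma geometric_le l l' : l <= l' -> geometric l <= geometric l'.
Proof. by elim: l l' => [|l IH] [|l'] //= /IH le; rewrite ltnS leq_mul2l le orbT. Qed.

Lemma word_code_bounds w :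
  geometric (size w) <= wcode w < geometric (size w).+1.
Proof.
elim: w => //= a w /andP[lo hi]; have aB := letter_code_lt a.
rewrite !ltnS (leq_trans (leq_mul (leqnn B) lo)) ?leq_addl //=.
rewrite (@leq_trans (B + B * wcode w)) ?ltn_add2r // -mulnS.
exact: leq_mul.
Qed.

Lemma rec_word_size k g : rec k g -> rec k (fun s => size (word_decode (g s))).
Proof.
apply: (@rec_app1 k (fun m => size (word_decode m))).
apply: (@rec_min 1 (fun s => (nth 0 s 1).+1 - geometric (nth 0 s 0).+1)).
- apply: rec_sub; first by apply: recS; apply: rec_nth.
  apply: (@rec_app1 2 geometric (fun s => (nth 0 s 0).+1)); last by apply: recS; apply: rec_nth.
  apply: (@rec_nat1 0 (fun _ r => (B * r).+1)) => //.
  by apply: recS; apply: rec_mul; [exact: rec_const|exact: rec_nth].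
- move=> x _ /=; set m := nth 0 x 0.
  by apply/eqP; have /andP[_] := word_code_bounds (word_decode m); rewrite word_decodeK subn_eq0.
move=> x n _ /=; set m := nth 0 x 0 => nm.
have /andP[lo _] := word_code_bounds (word_decode m).
have := geometric_le nm; rewrite word_decodeK /= in lo *.
by move=> le; apply/eqP; rewrite subn_eq0 -ltnNge ltnS (leq_trans le).
Qed.

Lemma rec_catc k g1 g2 : rec k g1 -> rec k g2 -> rec k (fun s => catc (g1 s) (g2 s)).
Proof.
move=> r1 r2; apply: (@rec_eq k (fun s => g1 s + B ^ size (word_decode (g1 s)) * g2 s)).
  by move=> s _; rewrite /catc word_code_cat !word_decodeK.
apply: rec_add => //; apply: rec_mul => //; apply: rec_expc.
exact: rec_word_size.
Qed.

Definition wpow k (w : word X) : word X := flatten (nseq k w).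
Definition powc k m := wcode (wpow k (word_decode m)).

Lemma powcE k u : powc k (wcode u) = wcode (wpow k u).
Proof. by rewrite /powc word_codeK. Qed.

Lemma rec_powc k g1 g2 : rec k g1 -> rec k g2 -> rec k (fun s => powc (g1 s) (g2 s)).
Proof.
apply: rec_app2; apply: (@rec_iter2 (fun=> 0) (fun _ r y => catc y r)) => //.
- exact: rec0.
- by apply: rec_catc; apply: rec_nth.
- by move=> n y; rewrite /powc /catc word_codeK.
Qed.

Lemma decidable_rel_semidec (P : word X -> word X -> Prop) :
  semidec 2 (fun x => P (word_decode (nth 0 x 0)) (word_decode (nth 0 x 1))) ->
  semidec 2 (fun x => ~ P (word_decode (nth 0 x 0)) (word_decode (nth 0 x 1))) ->
  decidable_rel P.
Proof.
move=> P1 P0; have [f rf fP] := semidec_decides P1 P0.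
exists (fun x => f x); split=> // u v.
by have /= := fP [:: wcode u; wcode v] erefl; rewrite !word_codeK.
Qed.

End WordCode.

(** * Flows *)

Local Open Scope classical_set_scope.
Local Open Scope group_scope.

Section Words.
Variables (X : choiceType) (G : groupType) (f : X -> G).

Lemma eval_nil : eval f [::] = 1.
Proof. exact: big_nil. Qed.

Lemma eval_cons a w : eval f (a :: w) = eval_letter f a * eval f w.
Proof. exact: big_cons. Qed.

Lemma eval_cat u v : eval f (u ++ v) = eval f u * eval f v.
Proof. exact: big_cat. Qed.

Lemma eval_rcons w a : eval f (rcons w a) = eval f w * eval_letter f a.
Proof. by rewrite -cats1 eval_cat eval_cons eval_nil mulg1. Qed.

Lemma eval_inv_letter a : eval_letter f (inv_letter a) = (eval_letter f a)^-1.
Proof. by case: a => x [] //=; rewrite /eval_letter /= invgK. Qed.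

Lemma eval_inv_word w : eval f (inv_word w) = (eval f w)^-1.
Proof.
elim: w => [|a w IH]; first by rewrite /inv_word eval_nil invg1.
by rewrite /inv_word /= rev_cons eval_rcons IH eval_inv_letter eval_cons invgM.
Qed.

Lemma eval_wpow k w : eval f (flatten (nseq k w)) = eval f w ^+ k.
Proof. by elim: k => [|k IH]; rewrite ?eval_nil //= eval_cat IH expgS. Qed.

End Words.

Section Flow.
Variable X : choiceType.
Local Notation F := (free_group X).
Local Notation ev := (eval (@free_gen X)).
Local Notation letter_elt := (eval_letter (@free_gen X)).
Implicit Types (A : F -> int) (a b : letter X) (w : word X) (g h k : F) (U V : set F).

(* The integral of the cochain that gives the oriented edge (g, g b) the value
   A g, and all edges with labels other than b and b^-1 the value 0, along the
   path spelled by w from 1. *)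
Fixpoint flow A b w : int :=
  if w is a :: w' then
    ((a == b)%:R * A 1%g - (a == inv_letter b)%:R * A (letter_elt a)
       + flow (fun g => A (letter_elt a * g)%g) b w')%R
  else 0%R.

Lemma eq_flow A A' b w : A =1 A' -> flow A b w = flow A' b w.
Proof. by move=> /funext->. Qed.

Lemma flow_cat A b u v :
  flow A b (u ++ v) = (flow A b u + flow (fun g => A (ev u * g)%g) b v)%R.
Proof.
elim: u A => [|a u IH] A /=.
  by rewrite GRing.add0r; apply: eq_flow => g; rewrite eval_nil mul1g.
rewrite IH GRing.addrA; congr (_ + _)%R.
by apply: eq_flow => g; rewrite eval_cons mulgA.
Qed.

Lemma inv_letter_neq a : inv_letter a != a.
Proof. by case: a => x []; rewrite /inv_letter xpair_eqE eqxx. Qed.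

(** A backtracking step crosses one edge in both directions. Hence the flow of a word depends only
    on its value in the free group. *)
Lemma flow_cancel A b a w : flow A b [:: a, inv_letter a & w] = flow A b w.
Proof.
rewrite /= eval_inv_letter mulgV !mulg1 GRing.addrA.
rewrite (inj_eq (inv_inj (@inv_letterK X))).
have -> : (inv_letter a == b) = (a == inv_letter b).
  by rewrite -{1}[b]inv_letterK (inj_eq (inv_inj (@inv_letterK X))).
rewrite (_ : flow _ b w = flow A b w); last first.
  by apply: eq_flow => g; rewrite !mulgA mulgV mul1g.
by rewrite GRing.subrKA GRing.subrr GRing.add0r.
Qed.

Lemma flow_push A b a w : flow A b (push a w) = flow A b (a :: w).
Proof.
case: w => //= c w; case: eqP => [->|//].
by rewrite -[RHS]/(flow A b [:: a, inv_letter a & w]) flow_cancel.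
Qed.

Lemma flow_mul_word A b u v : flow A b (mul_word u v) = flow A b (u ++ v).
Proof. by elim: u A => //= a u IH A; rewrite flow_push /= IH. Qed.

Definition gflow A b g : int := flow A b (free_word g).

Lemma gflow_eval A b w : gflow A b (ev w) = flow A b w.
Proof. by rewrite /gflow eval_free_gen flow_mul_word cats0. Qed.

Lemma eq_gflow A A' b g : A =1 A' -> gflow A b g = gflow A' b g.
Proof. exact: eq_flow. Qed.

(** The product rule of Fox calculus: the path of [h] starts at the vertex [g], which translates the
    cochain. *)
Lemma gflowM A b g h :
  gflow A b (g * h) = (gflow A b g + gflow (fun k => A (g * k)%g) b h)%R.
Proof.
rewrite -[g]eval_free_word -[h]eval_free_word -eval_cat !gflow_eval flow_cat.
by rewrite eval_free_word.
Qed.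

Lemma gflow1 A b : gflow A b 1 = 0%R.
Proof. by []. Qed.

Lemma gflowV A b g : gflow A b g^-1 = (- gflow (fun k => A (g^-1 * k)%g) b g)%R.
Proof.
by apply/eqP; rewrite -GRing.addr_eq0 -gflowM mulVg gflow1.
Qed.

Definition left_invariant U A := forall x g, U x -> A (x * g) = A g.

Lemma gflow_linvM U A b x g : left_invariant U A -> U x ->
  gflow A b (x * g) = (gflow A b x + gflow A b g)%R.
Proof.
by move=> UA Ux; rewrite gflowM; congr (_ + _)%R; apply: eq_gflow => k; apply: UA.
Qed.

Lemma gflow_linvV U A b x : subgroup U -> left_invariant U A -> U x ->
  gflow A b x^-1 = (- gflow A b x)%R.
Proof.
move=> [_ _ UV] UA Ux; rewrite gflowV; congr (- _)%R; apply: eq_gflow => k.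
exact/UA/UV.
Qed.

Lemma gflow_linvX U A b x n : left_invariant U A -> U x ->
  gflow A b (x ^+ n) = (n%:R * gflow A b x)%R.
Proof.
move=> UA Ux; elim: n => [|n IH]; first by rewrite GRing.mul0r.
by rewrite expgS (gflow_linvM _ _ UA) // IH -GRing.natr1 GRing.mulrDl GRing.mul1r GRing.addrC.
Qed.

(** The path runs along [c^-1], [g], [c]; the outer legs cancel because the cochain is invariant
    under [g ^ c]. *)
Lemma gflow_conj A b g c : (forall k, A (g ^ c * k) = A k) ->
  gflow A b (g ^ c) = gflow (fun k => A (c^-1 * k)%g) b g.
Proof.
move=> Ac; rewrite {1}/conjg !gflowM gflowV GRing.addrCA.
rewrite (_ : gflow (fun k => A (c^-1 * (g * k))%g) b c = gflow (fun k => A (c^-1 * k)%g) b c).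
  by rewrite GRing.addNr GRing.addr0.
by apply: eq_gflow => k; rewrite -[RHS]Ac /conjg !mulgA mulgK.
Qed.

(** On [N] the flow of an [N]-invariant cochain is additive, a homomorphism to the integers, and so
    it kills commutators. *)
Lemma gflow_derived (N : normal_subgroup F) A b g :
  left_invariant N A -> normal_set (derived N) g -> gflow A b g = 0%R.
Proof.
move=> NA; have sN := normal_subgroupP N; have [N1 NM NV] := sN.
move=> /(_ [set g | normal_set N g /\ gflow A b g = 0%R]) []//; split; first split.
- by split.
- move=> x y [Nx x0] [Ny y0]; split; first exact: NM.
  by rewrite (gflow_linvM _ _ NA) // x0 y0.
- move=> x [Nx x0]; split; first exact: NV.
  by rewrite (gflow_linvV _ sN NA) // x0 GRing.oppr0.
move=> _ [x Nx] [y Ny] <-.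
have Nxy : normal_set N (x ^ y) by apply: normal_conj.
split; rewrite /commg; first by apply: NM => //; apply: NV.
rewrite (gflow_linvM _ _ NA) ?(gflow_linvV _ sN NA) //; last exact: NV.
rewrite /conjg (gflow_linvM _ _ NA) ?(gflow_linvV _ sN NA) //; last exact: NV.
by rewrite (gflow_linvM _ _ NA) //; lia.
Qed.

Lemma flow_bound A b w : (forall g, (absz (A g) <= 1)%N) ->
  (absz (flow A b w) <= 2 * size w)%N.
Proof.
elim: w A => [|a w IH] A A1 /=; first by [].
have := IH (fun g => A (letter_elt a * g)) (fun g => A1 _).
have := A1 1; have := A1 (letter_elt a).
move: (flow _ b w) (A _) (A 1) => x y z.
by case: eqP; case: eqP => /=; lia.
Qed.

(* The path spelled by w crosses no edge with label b on which A is non-zero. *)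
Definition avoids A b w := forall i, (i < size w)%N ->
  (nth b w i = b -> A (ev (take i w)) = 0%R) /\
  (nth b w i = inv_letter b -> A (ev (take i.+1 w)) = 0%R).

Lemma flow_avoids A b w : avoids A b w -> flow A b w = 0%R.
Proof.
elim: w A => //= a w IH A avA; have [av1 av2] := avA 0%N isT.
rewrite IH => [|i iw]; last first.
  have [] := avA i.+1 iw; rewrite /= !eval_cons.
  by move=> ? ?; split.
rewrite /= ?take0 ?eval_cons eval_nil ?mulg1 in av1 av2.
by case: eqP => [/av1->|_]; case: eqP => [/av2->|_] /=; lia.
Qed.

Lemma avoids_take A b w n : avoids A b w -> avoids A b (take n w).
Proof.
move=> avA i; rewrite size_take_min => iw.
have [inn iw'] : (i < n /\ i < size w)%N by lia.
by rewrite nth_take // !take_takel //; [apply: avA|lia].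
Qed.

End Flow.

(** * Cycles in Schreier graphs *)

Section Cycles.
Variable X : choiceType.
Local Notation F := (free_group X).
Local Notation ev := (eval (@free_gen X)).
Local Notation letter_elt := (eval_letter (@free_gen X)).
Implicit Types (A : F -> int) (a b : letter X) (t w z : word X) (f g h x y : F) (U V : set F).

(** This is [f^-1 U f], the set of loops at the vertex [U f] of the graph of right cosets of [U]. *)
Definition conj_set f U : set F := [set x | U (x ^ f^-1)].

Lemma conj_subgroup f U : subgroup U -> subgroup (conj_set f U).
Proof.
case=> U1 UM UV; rewrite /conj_set; split=> [|x y|x] /=; rewrite ?conj1g ?conjMg ?conjVg //.
  exact: UM.
exact: UV.
Qed.

(* In the graph of right cosets of V, the path spelled by t from the coset V is
   a cycle without repeated vertices. *)
Definition simple_cycle V t := [/\ (0 < size t)%N, V (ev t),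
  forall i j, (i < j < size t)%N -> ~ V (ev (take j t) * (ev (take i t))^-1)
  & (1 < size t)%N -> forall a, last a t != inv_letter (head a t)].

(** Over all base points, take a shortest word that is a loop for [V] but not for [U]. A repeated
    vertex would cut it into two shorter [V]-loops, which lie in [U] by minimality, and so would the
    whole word. *)
Lemma shortest_cycle U V : subgroup U -> subgroup V ->
  (exists x, V x /\ ~ U x) ->
  exists f t, ~ conj_set f U (ev t) /\ simple_cycle (conj_set f V) t.
Proof.
move=> [U1 UM UV] [V1 VM VV] [x [Vx nUx]].
pose P n := `[< exists f t, [/\ size t = n, V (ev t ^ f^-1) & ~ U (ev t ^ f^-1)] >].
have exP : exists n, P n.
  exists (size (free_word x)); apply/asboolP; exists 1, (free_word x).
  by rewrite eval_free_word invg1 conjg1.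
case: (ex_minnP exP) => n /asboolP[f [t [<- Vt nUt]]] {exP} minP.
have short g s : (size s < size t)%N -> V (ev s ^ g^-1) -> U (ev s ^ g^-1).
  move=> st Vs; apply: contrapT => nUs.
  have : P (size s) by apply/asboolP; exists g, s.
  by move=> /minP; rewrite leqNgt st.
exists f, t; split=> //; split=> //.
- by case: (t) nUt => // nU; case: nU; rewrite eval_nil conj1g.
- move=> i j /andP[ij jt].
  set s1 := take i t; pose s2 := drop i (take j t); pose s3 := drop j t.
  have s12 : take j t = s1 ++ s2 by rewrite -(cat_take_drop i (take j t)) take_takel // ltnW.
  have s123 : t = s1 ++ s2 ++ s3 by rewrite catA -s12 cat_take_drop.
  rewrite s12 eval_cat /conj_set /= => V12.
  have E : ev s2 ^ (f * ev s1)^-1 = (ev s1 * ev s2 * (ev s1)^-1) ^ f^-1.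
    by rewrite invgM conjgM; congr (_ ^ _); rewrite /conjg invgK mulgA.
  have Us2 : U (ev s2 ^ (f * ev s1)^-1).
    by apply: short; rewrite ?E // size_drop size_takel; lia.
  have tE : ev t ^ f^-1 = (ev s2 ^ (f * ev s1)^-1) * ev (s1 ++ s3) ^ f^-1.
    by rewrite E -conjMg s123 !eval_cat -!mulgA mulKg.
  apply: nUt; rewrite tE; apply: UM => //; apply: short.
    by rewrite size_cat size_takel ?size_drop; lia.
  rewrite -[_ ^ _](mulKg (ev s2 ^ (f * ev s1)^-1)) -tE.
  by apply: VM => //; apply: VV; rewrite E.
(* If the last letter cancels the first, moving the base point along the first letter shortens the
   loop. *)
move=> t_gt1 a; apply/eqP => lastE; case: t t_gt1 nUt Vt lastE short {minP} => // c s.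
case/lastP: s => //= s d _ nU Vt; rewrite last_rcons => dE; subst d => short; apply: nU.
have E : ev (c :: rcons s (inv_letter c)) ^ f^-1 = ev s ^ (f * letter_elt c)^-1.
  rewrite eval_cons eval_rcons eval_inv_letter invgM conjgM; congr (_ ^ _).
  by rewrite /conjg invgK.
rewrite E; apply: short; first by rewrite size_rcons.
by rewrite -E.
Qed.

(** If the reduced word of [x] starts with [a^-1], its inverse is tried; if that fails too, the word
    ends with [a], and stripping both end letters gives a shorter conjugate in [N]. *)
Lemma reduced_continuation (N : normal_subgroup F) x a : normal_set N x -> x <> 1 ->
  exists w, [/\ (0 < size w)%N, reduced (a :: w) & normal_set N (ev w)].
Proof.
move=> Nx x1; have [_ _ NV] := normal_subgroupP N.
have [n] := ubnP (size (free_word x)).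
have : free_word x <> [::] by move=> x0; apply: x1; apply: val_inj.
have := free_wordP x; move: Nx; rewrite -{1}(eval_free_word x) {x1}.
elim: n (free_word x) => // n IH w Nw rw w0 wn.
case: (eqVneq (head a w) (inv_letter a)) => [wa|wa]; last first.
  exists w; split=> //; first by case: (w) w0.
  by case: (w) wa rw w0 => //= c s ->.
case/lastP: w w0 Nw rw wa wn => // w l _ Nw rw wa wn.
case: (eqVneq l a) => [la|la]; last first.
  exists (inv_word (rcons w l)); rewrite eval_inv_word; split.
  - by rewrite /inv_word size_rev size_map size_rcons.
  - have := reduced_inv rw; rewrite /inv_word map_rcons rev_rcons /= => ->.
    by rewrite andbT (inj_eq (inv_inj (@inv_letterK X))).
  - exact: NV.
subst l; case: w wa wn rw Nw => [aa|c w] /=.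
  by have := inv_letter_neq a; rewrite -aa eqxx.
move=> -> wn rw; rewrite rcons_path in rw; case/andP: rw => rw lw.
rewrite eval_cons eval_rcons eval_inv_letter => Nw; apply: (IH w).
- by have := normal_conj (letter_elt a)^-1 Nw; rewrite /conjg invgK !mulgA mulgV mul1g mulgK.
- exact: path_sorted rw.
- by move=> w0; move: lw; rewrite w0 /= inv_letterK eqxx.
by rewrite size_rcons in wn; lia.
Qed.

Definition supported V g0 A := forall g, ~ V (g * g0^-1) -> A g = 0%R.

(* The element alpha leaves the cycle t through the letter a and follows a
   reduced path until its first return, in the graph of cosets of V, to the
   cycle or to itself; the last edge (g0, b) of that path is then crossed only
   once by alpha, and never by t. *)
Lemma crossing (N : normal_subgroup F) x V t : normal_set N x -> x <> 1 ->
  subgroup V -> (forall y, normal_set N y -> V y) ->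
  (forall b c : letter X, exists a, a != b /\ a != c) -> simple_cycle V t ->
  exists alpha g0 b, V alpha /\ forall A, supported V g0 A ->
    flow A b t = 0%R /\ gflow A b alpha = A g0.
Proof.
move=> Nx x1 [V1 VM VV] NV letters [t_gt0 Vt simple_t _].
case: t t_gt0 Vt simple_t => // t0 t' _; set t := t0 :: t' => Vt simple_t.
(* The letter [a] leaves the base vertex neither along the first edge of the cycle nor back along
   its last edge. *)
have [a [at0 alast]] := letters t0 (inv_letter (last t0 t')).
have [w [w_gt0 redz Nw]] := reduced_continuation a Nx x1.
set z := a :: w in redz *.
pose T i := ev (take i t); pose Z i := ev (take i z).
have VVr g h : V (g * h^-1) -> V (h * g^-1).
  by move=> /VV; rewrite invgM invgK.
(* After [k] letters the walk [z] meets the cycle or one of its own earlier vertices. *)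
pose hit k := (exists2 i, (i < size t)%N & V (Z k * (T i)^-1)) \/
              (exists2 j, (j < k)%N & V (Z k * (Z j)^-1)).
have hitz : hit (size w).+1.
  right; exists 1%N; first by rewrite ltnS.
  rewrite /Z /z /= take_size take0 !eval_cons eval_nil mulg1; apply: NV.
  by have := normal_conj (letter_elt a)^-1 Nw; rewrite /conjg invgK mulgA.
have exk : exists k, `[< hit k.+1 >] by exists (size w); apply/asboolP.
case: (ex_minnP exk) => k /asboolP hitk mink {exk}.
have kz : (k < size z)%N by rewrite ltnS; apply: mink; apply/asboolP.
have nohit : ~ ((0 < k)%N /\ hit k).
  by case: (k) mink => [|k'] mink' [] // _ /asboolP /mink'; rewrite ltnn.
set g0 := Z k; set b := nth a z k.
have T0 : T 0%N = 1 by rewrite /T take0 eval_nil.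
have Z0 : Z 0%N = 1 by rewrite /Z take0 eval_nil.
have away i : (i < size t)%N -> V (T i * g0^-1) -> k = 0%N /\ i = 0%N.
  move=> it VT; have k0 : k = 0%N.
    apply/eqP; rewrite -leqn0 leqNgt; apply/negP => k_gt0; apply: nohit; split=> //.
    by left; exists i => //; apply: VVr.
  split=> //; apply/eqP; rewrite -leqn0 leqNgt; apply/negP => i_gt0.
  by case: (simple_t 0%N i); rewrite ?i_gt0 // -/(T _) -/(T _) T0 -Z0 -k0.
have avt A : supported V g0 A -> avoids A b t.
  move=> supA i it; split=> bE; apply: supA => VT.
    have [k0 i0] := away i it VT.
    by move: bE at0; rewrite /b k0 i0 /= => ->; rewrite eqxx.
  have [it'|ti] := ltnP i.+1 (size t); first by have [] := away i.+1 it' VT.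
  have iE : i.+1 = size t by apply/eqP; rewrite eqn_leq it ti.
  rewrite iE take_size in VT.
  have V0 : V (T 0%N * g0^-1).
    rewrite T0 mul1g -[g0^-1](mulKg (ev t)); apply: VM => //; exact: VV.
  have [k0 _] := away 0%N isT V0; move: bE alast.
  have -> : i = size t' by case: iE.
  rewrite -[nth _ _ _]/(nth b (t0 :: t') (size (t0 :: t')).-1) nth_last /= => ->.
  by rewrite inv_letterK /b k0 eqxx.
(* Before its first hit the walk visits no vertex twice, and it cannot have arrived at [g0] by the
   same edge backwards because [z] is reduced. *)
have avz A : supported V g0 A -> avoids A b (take k z).
  move=> supA i; rewrite size_takel ?(ltnW kz) // => ik.
  have k_gt0 := leq_ltn_trans (leq0n i) ik.
  rewrite nth_take // !take_takel //; last exact: ltnW.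
  split=> bE; apply: supA => VZ.
    by apply: nohit; split=> //; right; exists i => //; apply: VVr.
  move: ik; rewrite leq_eqVlt => /predU1P[ik|ik]; last first.
    by apply: nohit; split=> //; right; exists i.+1 => //; apply: VVr.
  have iz : (i.+1 < size z)%N by rewrite ik.
  have /sortedP /(_ i iz) := redz => /(_ a); rewrite ik -/b.
  by rewrite (set_nth_default b) ?(ltnW iz) // bE inv_letterK eqxx.
have flowZ A : supported V g0 A -> gflow A b (Z k.+1) = A g0.
  move=> supA; rewrite /Z gflow_eval (take_nth a kz) -cats1 flow_cat.
  rewrite flow_avoids; last exact: avz.
  by rewrite /= -/b eqxx mulg1 [b == _]eq_sym (negbTE (inv_letter_neq b)) /=
    GRing.mul1r GRing.mul0r GRing.subr0 GRing.addr0 GRing.add0r.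
(* The loop is closed by returning along the cycle or the walk, neither of which crosses the last
   edge. *)
have [r Vr flowr] : exists2 r, V (Z k.+1 * (ev r)^-1) &
    forall A, supported V g0 A -> flow A b r = 0%R.
  case: hitk => [[i it Vi]|[j jk Vj]].
    by exists (take i t) => // A /avt avA; apply/flow_avoids/avoids_take.
  exists (take j z) => // A /avz avA.
  by rewrite -(@take_takel _ j k) //; apply/flow_avoids/avoids_take.
exists (Z k.+1 * (ev r)^-1), g0, b; split=> // A supA; split; first exact/flow_avoids/avt.
rewrite gflowM flowZ // gflowV gflow_eval flowr ?GRing.subr0 // => g nV.
rewrite mulgA; apply: supA => Vg; apply: nV.
rewrite -[_ * _](mulKg (Z k.+1 * (ev r)^-1)); apply: VM; first exact: VV.
by rewrite mulgA.
Qed.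

(** As a cochain, this makes [flow] count the signed crossings of the edge labelled [b] at the
    vertex [U h]. *)
Definition ind U h g : int := if `[< U (g * h^-1) >] then 1%R else 0%R.

Lemma ind1 U h g : U (g * h^-1) -> ind U h g = 1%R.
Proof. by move=> /asboolT; rewrite /ind => ->. Qed.

Lemma ind0 U h g : ~ U (g * h^-1) -> ind U h g = 0%R.
Proof. by move=> /asboolF; rewrite /ind => ->. Qed.

Lemma absz_ind U h g : (absz (ind U h g) <= 1)%N.
Proof. by rewrite /ind; case: ifP. Qed.

Lemma ind_linv U h : subgroup U -> left_invariant U (ind U h).
Proof.
move=> [_ UM UV] x g Ux; rewrite /ind; congr (if _ then _ else _).
apply: asbool_equiv_eq; split=> [Uxg|Ug]; last by rewrite -mulgA; apply: UM.
by rewrite -[_ * _](mulKg x); apply: UM; [exact: UV|rewrite mulgA].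
Qed.

(** Up to conjugation, the element is the commutator of a shortest loop [t] of [V] outside [U] and
    the loop [alpha] of [crossing]. Among the two, only [alpha] crosses the chosen edge of the graph
    of [V], so the flow of the commutator over that edge sits at [g0] and at [t g0], with opposite
    signs. *)
Lemma abelian_core (N : normal_subgroup F) x U V v : normal_set N x -> x <> 1 ->
  subgroup U -> subgroup V -> (forall y, normal_set N y -> U y) -> (forall y, U y -> V y) ->
  (forall y y', V y -> V y' -> normal_set N (y * y' * (y' * y)^-1)) ->
  (forall b c : letter X, exists a, a != b /\ a != c) -> V v -> ~ U v ->
  exists m, normal_set N m /\
    exists g b, gflow (ind U g) b m <> gflow (ind U (v * g)) b m.
Proof.
move=> Nx x1 sU sV NU UV abV letters Vv nUv; have [U1 UM UVi] := sU; have [V1 VM VVi] := sV.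
have [f [t [nUt cyc]]] := shortest_cycle sU sV (ex_intro _ v (conj Vv nUv)).
have [||alpha [g0 [b [Va flowE]]]] := crossing Nx x1 _ _ letters cyc.
- exact: conj_subgroup.
- by move=> y Ny; apply/UV/NU/normal_conj.
have [_ Vt _ _] := cyc.
pose m := alpha * ev t * (ev t * alpha)^-1.
have Nmf : normal_set N (m ^ f^-1).
  rewrite /m conjMg conjVg !conjMg; exact: abV.
have Nm : normal_set N m by have := normal_conj f Nmf; rewrite -conjgM mulVg conjg1.
have flowm A : left_invariant N A -> supported (conj_set f V) g0 A ->
    gflow A b m = (A g0 - A (ev t * g0)%g)%R.
  move=> NA supA.
  have supM y : conj_set f V y -> supported (conj_set f V) g0 (fun k => A (y * k)).
    move=> Vy k nV; apply: supA => Vyk; apply: nV.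
    have [_ cM cV] := conj_subgroup f sV.
    by rewrite -[_ * _](mulKg y); apply: cM; [exact: cV|rewrite mulgA].
  rewrite /m gflowM gflowV (@eq_gflow _ _ A); last by move=> k; rewrite mulgA -/m; apply: NA.
  rewrite !gflowM !gflow_eval; have [-> ->] := flowE _ supA.
  have [-> _] := flowE _ (supM _ Va); have [_ ->] := flowE _ (supM _ Vt).
  by rewrite GRing.addr0 GRing.add0r.
have conj_flow h : gflow (ind U h) b (m ^ f^-1) = gflow (fun k => ind U h (f * k)%g) b m.
  rewrite gflow_conj => [|k]; last by rewrite (ind_linv _ sU) //; apply: NU.
  by rewrite invgK.
have linv h : left_invariant N (fun k => ind U h (f * k)).
  move=> y k Ny; rewrite (_ : f * (y * k) = y ^ f^-1 * (f * k)); last first.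
    by rewrite /conjg invgK -!mulgA mulKg.
  by apply: (ind_linv _ sU); apply/NU/normal_conj.
(* The flow is 1 at [f g0], since [t] is outside the conjugate of [U]; at the translate by [v] it is
   0 or -1, since [v] is outside [U]. *)
exists (m ^ f^-1); split=> //; exists (f * g0), b; rewrite !conj_flow !flowm //.
- rewrite ind1 ?mulgV // ind0; last first.
    by move=> Uh; apply: nUt; rewrite /conj_set /= /conjg invgK; move: Uh; rewrite invgM !mulgA mulgK.
  rewrite ind0; last first.
    move=> Uh; apply: nUv; move: Uh; rewrite !invgM !mulgA mulgK mulgV mul1g => /UVi.
    by rewrite invgK.
  by rewrite /ind; case: ifP.
- move=> k nV; apply: ind0 => Uk; apply: nV; rewrite /conj_set /= /conjg invgK.
  have := VM _ _ (UV _ Uk) Vv; rewrite !invgM !mulgA.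
  by rewrite mulgVK.
move=> k nV; apply: ind0 => Uk; apply: nV; rewrite /conj_set /= /conjg invgK.
by have := UV _ Uk; rewrite !invgM !mulgA.
Qed.

End Cycles.

(** * Certificates that v is not a power of u modulo N *)

Section Cosets.
Variables (G : groupType) (M : normal_subgroup G).
Implicit Types x y : G.

Lemma coset1 : coset M 1 = 1.
Proof. by []. Qed.

Lemma cosetM x y : coset M (x * y) = coset M x * coset M y.
Proof. by rewrite -quotient_mulE. Qed.

Lemma cosetV x : coset M x^-1 = (coset M x)^-1.
Proof. by rewrite -quotient_invE. Qed.

Lemma cosetX x n : coset M (x ^+ n) = coset M x ^+ n.
Proof. by elim: n => [|n IH]; rewrite ?coset1 // !expgS cosetM IH. Qed.

Lemma cosetJ x y : coset M (x ^ y) = coset M x ^ coset M y.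
Proof. by rewrite /conjg !cosetM cosetV. Qed.

Lemma coset_eq1 x : coset M x = 1 <-> normal_set M x.
Proof.
have [_ _ MV] := normal_subgroupP M.
rewrite -coset1 cosetP mulg1; split=> [/MV|/MV] //; by rewrite invgK.
Qed.

Lemma derived_sub x : normal_set (derived M) x -> normal_set M x.
Proof.
have sM := normal_subgroupP M; have [_ MM MV] := sM; apply; split=> // _ [y My] [z Mz] <-.
by rewrite /commg; apply: MM; [apply: MV|apply: normal_conj].
Qed.

Lemma coset_derived x y : coset (derived M) x = coset (derived M) y ->
  coset M x = coset M y.
Proof. by move=> /cosetP/derived_sub/cosetP. Qed.

Lemma coset_derivedC x y : normal_set M x -> normal_set M y ->
  coset (derived M) (x * y) = coset (derived M) (y * x).
Proof.
move=> Mx My; apply/cosetP; rewrite invgM -!mulgA => H [_]; apply.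
by exists y => //; exists x => //; rewrite /commg /conjg.
Qed.

End Cosets.

Lemma eval_quotient_gen (X : choiceType) (K : normal_subgroup (free_group X)) w :
  eval (quotient_gen K) w = coset K (eval (@free_gen X) w).
Proof.
elim: w => [|a w IH]; first by rewrite !eval_nil.
by rewrite !eval_cons cosetM IH; case: a => x [] //=; rewrite /eval_letter /= cosetV.
Qed.


Section Certificates.
Variables (X : choiceType) (N : normal_subgroup (free_group X)).
Local Notation F := (free_group X).
Local Notation ev := (eval (@free_gen X)).
Local Notation D := (derived N).
Implicit Types (A : F -> int) (b : letter X) (w : word X) (g h c m n u v x y : F) (U : set F).

Definition commute_mod x y := coset N (x * y) = coset N (y * x).

(* The full preimage in F of the cyclic subgroup of F / N generated by u; two
   natural exponents stand for the integer exponent j - i. *)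
Definition cyclic_mod u : set F :=
  [set g | exists i j, coset N (g * u ^+ i) = coset N (u ^+ j)].

Lemma commute_coset x y : commute_mod x y -> commute (coset N x) (coset N y).
Proof. by rewrite /commute_mod !cosetM. Qed.

Lemma coset_commute x y : commute (coset N x) (coset N y) -> commute_mod x y.
Proof. by rewrite /commute_mod !cosetM. Qed.

Lemma commute_mod_subgroup (S : set F) :
  subgroup [set g | forall h, S h -> commute_mod g h].
Proof.
split=> [h _|x y Cx Cy h Sh|x Cx h Sh]; apply/coset_commute/commute_sym.
- exact: commute1.
- rewrite cosetM; apply: commuteM; apply/commute_sym/commute_coset.
    exact: Cx.
  exact: Cy.
- by rewrite cosetV; apply/commuteV/commute_sym/commute_coset/Cx.
Qed.

Lemma commute_mod_sym x y : commute_mod x y -> commute_mod y x.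
Proof. by rewrite /commute_mod => ->. Qed.

Lemma normal_commute_mod x y : normal_set N x -> commute_mod x y.
Proof. by rewrite -coset_eq1 /commute_mod !cosetM => ->; rewrite mulg1 mul1g. Qed.

Lemma commute_mod_comm x y : commute_mod x y -> normal_set N (x * y * (y * x)^-1).
Proof. by move=> xy; rewrite -coset_eq1 cosetM cosetV xy mulgV. Qed.

Lemma cyclic_mod_subgroup u : subgroup (cyclic_mod u).
Proof.
split=> [|x y [i [j xE]] [k [l yE]]|x [i [j xE]]].
- by exists 0%N, 0%N; rewrite mulg1.
- move: xE yE; rewrite !cosetM !cosetX => xE yE.
  exists (k + i)%N, (j + l)%N; rewrite !cosetM !cosetX expgnDr mulgA.
  by rewrite -(mulgA (coset N x)) yE -mulgA -expgnDr addnC expgnDr mulgA xE -expgnDr.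
- by exists j, i; rewrite cosetM -xE -cosetM mulKg.
Qed.

Lemma normal_cyclic_mod u x : normal_set N x -> cyclic_mod u x.
Proof. by move/coset_eq1=> x1; exists 0%N, 0%N; rewrite mulg1. Qed.

Lemma cyclic_mod_id u : cyclic_mod u u.
Proof. by exists 0%N, 1%N; rewrite mulg1. Qed.

Lemma cyclic_mod_min u (R : set F) : subgroup R -> (forall x, normal_set N x -> R x) ->
  R u -> forall x, cyclic_mod u x -> R x.
Proof.
move=> [R1 RM RV] NR Ru x [i [j]] /cosetP/NR Rx.
have RX k : R (u ^+ k) by elim: k => // k IH; rewrite expgS; apply: RM.
have := RM _ _ (RX j) (RV _ Rx).
rewrite invgM invgK mulVKg => /(RM _ _)/(_ (RV _ (RX i))).
by rewrite mulgK.
Qed.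

Lemma cyclic_mod_commute u x : cyclic_mod u x -> commute_mod x u.
Proof.
have sC := commute_mod_subgroup [set u].
move=> /(cyclic_mod_min sC) Cx; apply: Cx => // [y Ny h _|h ->//].
exact: normal_commute_mod.
Qed.

Lemma cyclic_mod_conj u c x : commute_mod c u -> cyclic_mod u (x ^ c) <-> cyclic_mod u x.
Proof.
move=> /commute_coset cu.
have cX k : coset N u ^+ k = (coset N u ^+ k) ^ coset N c.
  by apply/esym/conjg_fixP/commgP/commute_sym/commuteX.
split=> -[i [j E]]; exists i, j; move: E;
  rewrite (cosetM N (x ^ c)) (cosetM N x) cosetJ !cosetX.
  by rewrite {1}(cX i) {1}(cX j) -conjMg => /conjg_inj.
by move=> E; rewrite (cX i) -conjMg E -cX.
Qed.

(** As [c] normalizes [U], left translation by [c] acts on the coset graph, and it carries the flow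
    of [x ^ c] to that of [x]. *)
Lemma gflow_ind_conj U b c g x : subgroup U -> (forall y, U (y ^ c) <-> U y) -> U x ->
  gflow (ind U g) b (x ^ c) = gflow (ind U (c * g)) b x.
Proof.
move=> sU Uc Ux; rewrite gflow_conj => [|k]; last exact/(ind_linv _ sU)/Uc.
apply: eq_gflow => k; rewrite /ind; congr (if _ then _ else _); apply: asbool_equiv_eq.
by rewrite -[X in _ <-> X]Uc /conjg invgM !mulgA mulgVK.
Qed.

Lemma gflow_coset A b x y : left_invariant N A -> coset D x = coset D y ->
  gflow A b x = gflow A b y.
Proof.
move=> NA /cosetP Dxy; rewrite -[y](mulVKg x) gflowM.
rewrite [X in (_ + X)%R](@gflow_derived _ N) ?GRing.addr0 // => n k Nn.
rewrite (_ : x * (n * k) = n ^ x^-1 * (x * k)); first exact/NA/normal_conj.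
by rewrite /conjg invgK -!mulgA mulKg.
Qed.

Lemma eq_ind U h y : subgroup U -> U y -> ind U (y * h) =1 ind U h.
Proof.
move=> [_ UM UV] Uy g; rewrite /ind; congr (if _ then _ else _); apply: asbool_equiv_eq.
rewrite invgM mulgA; split=> [/UM/(_ Uy)|/UM/(_ (UV _ Uy))//]; by rewrite mulgVK.
Qed.

Variable n0 : F.
Hypotheses (Nn0 : normal_set N n0) (n0_neq1 : n0 <> 1).
Hypothesis letters : forall b b' : letter X, exists a, a != b /\ a != b'.

Lemma noncommuting v : ~ normal_set N v ->
  exists m, normal_set N m /\ coset D (m * v) <> coset D (v * m).
Proof.
move=> nNv; have sN := normal_subgroupP N.
(* [V] is the double centralizer of [v] modulo [N]: it contains [v] and is commutative modulo
   [N]. *)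
pose C := [set h | commute_mod h v]; pose V := [set g | forall h, C h -> commute_mod g h].
have sV : subgroup V by apply: commute_mod_subgroup.
have Vv : V v by move=> h /commute_mod_sym.
have Vab x y : V x -> V y -> normal_set N (x * y * (y * x)^-1).
  by move=> Vx Vy; apply/commute_mod_comm/Vx/Vy.
have NV x : normal_set N x -> V x by move=> Nx h _; apply: normal_commute_mod.
have [m [Nm [g [b neq]]]] := abelian_core Nn0 n0_neq1 sN sV (fun _ => id) NV Vab letters Vv nNv.
exists m; split=> // E; apply: neq; rewrite -gflow_ind_conj //; last first.
  move=> y; split=> [|Ny]; last exact: normal_conj.
  by move=> /(@normal_conj _ N _ v^-1); rewrite -conjgM mulgV conjg1.
apply: gflow_coset; first exact: ind_linv.
by rewrite /conjg cosetM E -cosetM mulKg.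
Qed.

Section Commuting.
Variable u : F.
Local Notation U := (cyclic_mod u).
Let sU : subgroup U := cyclic_mod_subgroup u.

Lemma commuting_core v : commute_mod v u -> ~ U v ->
  exists m, normal_set N m /\
    exists g b, gflow (ind U g) b m <> gflow (ind U (v * g)) b m.
Proof.
move=> vu nUv.
(* The double centralizer of [u] and [v] is commutative modulo [N] because [u] and [v] commute
   there. *)
pose C := [set h | commute_mod h u /\ commute_mod h v].
pose V := [set g | forall h, C h -> commute_mod g h].
have sV : subgroup V by apply: commute_mod_subgroup.
have Vu : V u by move=> h [/commute_mod_sym].
have Vv : V v by move=> h [_ /commute_mod_sym].
have NV x : normal_set N x -> V x by move=> Nx h _; apply: normal_commute_mod.
have Vab x y : V x -> V y -> normal_set N (x * y * (y * x)^-1).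
  move=> Vx Vy; apply/commute_mod_comm/Vx; split.
    by apply: Vy; split=> //; apply: commute_mod_sym.
  by apply: Vy; split.
have UV := cyclic_mod_min sV NV Vu.
exact: (abelian_core Nn0 n0_neq1 sU sV (@normal_cyclic_mod u) UV Vab letters Vv).
Qed.

(** Left translation by [c] is an automorphism of the Schreier graph of [<u>N] that preserves the
    flow of [m]. *)
Definition stabilizes m c := commute_mod c u /\
  forall g b, gflow (ind U g) b m = gflow (ind U (c * g)) b m.

Lemma absz_add (x y : int) k l :
  (absz x <= k)%N -> (absz y <= l)%N -> (absz (x + y)%R <= k + l)%N.
Proof. by lia. Qed.

(** Uniqueness of digits in base [K]: low digits of size at most [L] differ by less than [K]. *)
Lemma gflow_digits (K L : nat) (x x' y y' : int) : (2 * L < K)%N ->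
  (absz y <= L)%N -> (absz y' <= L)%N ->
  (y + K%:R * x = y' + K%:R * x')%R -> x = x'.
Proof.
move=> LK yL yL' E; rewrite !natz in E.
have [//|neq] := eqVneq x x'; exfalso.
have : (absz (x - x')%R * K <= 2 * L)%N; last by nia.
by rewrite -[K]absz_nat -abszM; lia.
Qed.

(** The list represents the cosets of [U] that may still contain unwanted stabilizers. To clear the
    coset of such a [c], replace [n] by [m n^K], where [c] does not preserve the flow of [m]; by the
    digit argument, stabilizers of the new element preserve the flows of both [m] and [n]. *)
Lemma rigid_from_list (ks : seq F) n : normal_set N n ->
  (forall c, stabilizes n c -> U c \/ exists2 k, k \in ks & U (c * k^-1)) ->
  exists n', normal_set N n' /\ forall c, stabilizes n' c -> U c.
Proof.
have [U1 UM UV] := sU; have [_ NM _] := normal_subgroupP N.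
elim: ks n => [|k ks IH] n Nn stab.
  by exists n; split=> // c /stab[//|[]].
case: (pselect (exists c, [/\ stabilizes n c, U (c * k^-1) & ~ U c])); last first.
  move=> nex; apply: (IH n) => // c sc; have [|[k']] := stab c sc; first by left.
  rewrite inE => /predU1P[->|k'ks] Uck; last by right; exists k'.
  by left; apply: contrapT => nUc; apply: nex; exists c.
case=> c [[cu _] Uck nUc]; have [m [Nm [g0 [b0 neq]]]] := commuting_core cu nUc.
pose L := (2 * size (free_word m))%N; pose K := (2 * L).+1.
have NU x : normal_set N x -> U x by apply: normal_cyclic_mod.
have Nx : normal_set N (n ^+ K).
  by rewrite -coset_eq1 cosetX; move/coset_eq1: Nn => ->; rewrite expg1n.
have flowE g b : gflow (ind U g) b (m * n ^+ K) =
    (gflow (ind U g) b m + K%:R * gflow (ind U g) b n)%R.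
  rewrite (gflow_linvM _ _ (ind_linv g sU)) ?(gflow_linvX _ _ (ind_linv g sU)) //; exact: NU.
apply: (IH (m * n ^+ K)) => [|c' [c'u st']]; first exact: NM.
have eqn g b : gflow (ind U g) b n = gflow (ind U (c' * g)) b n.
  have := st' g b; rewrite !flowE; apply: (@gflow_digits _ L) => //.
    by apply: flow_bound => h; apply: absz_ind.
  by apply: flow_bound => h; apply: absz_ind.
have [|[k']] := stab c' (conj c'u eqn); first by left.
rewrite inE => /predU1P[->|k'ks] Uck'; last by right; exists k'.
case: neq; have := st' g0 b0; rewrite !flowE -eqn => /GRing.addIr ->.
apply: eq_gflow => h; rewrite -[c'](mulgVK c) -mulgA (eq_ind (c * g0) sU) //.
by have := UM _ _ Uck' (UV _ Uck); rewrite invgM invgK mulgA mulgVK.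
Qed.

(** A stabilizer sends an edge of non-zero flow to one crossed by the finite word of [m], which
    leaves finitely many cosets of [U]. *)
Lemma rigid v : commute_mod v u -> ~ U v ->
  exists n, normal_set N n /\ forall c, stabilizes n c -> U c.
Proof.
move=> vu nUv; have [m [Nm [g [b neq]]]] := commuting_core vu nUv.
have [h hneq] : exists h, gflow (ind U h) b m <> 0%R.
  case: (pselect (gflow (ind U g) b m = 0%R)) => [E|]; last by exists g.
  by exists (v * g) => E'; apply: neq; rewrite E E'.
pose w := free_word m.
apply: (@rigid_from_list [seq ev (take i w) * h^-1 | i <- iota 0 (size w).+1] m Nm).
move=> c [_ st]; right; apply: contrapT => nex; apply: hneq; rewrite st.
have out i : (i <= size w)%N -> ind U (c * h) (ev (take i w)) = 0%R.
  move=> iw; apply: ind0 => Ui; apply: nex; exists (ev (take i w) * h^-1).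
    by apply/mapP; exists i; rewrite ?mem_iota ?add0n ?ltnS.
  have [_ _ UV] := sU.
  by have := UV _ Ui; rewrite !invgM !invgK mulgA.
by apply: flow_avoids => i iw; split=> _; apply: out => //; apply: ltnW.
Qed.

Lemma nonconjugate v : commute_mod v u -> ~ U v ->
  exists n m, [/\ normal_set N n, normal_set N m &
    forall c, coset D (u * n * m ^ v) <> coset D ((u * n * m) ^ c)].
Proof.
move=> vu nUv; have [n [Nn rig]] := rigid vu nUv.
have [m [Nm [g0 [b0 neq]]]] := commuting_core vu nUv.
have [U1 UM UV] := sU; have NU x : normal_set N x -> U x by apply: normal_cyclic_mod.
(* [L] bounds the low digits on both sides, so that base [K] isolates the flow of [n]. *)
pose L := (2 * size (free_word u) + 2 * size (free_word m) + 2 * size (free_word (m ^ v)%g))%N.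
pose K := (2 * L).+1; exists (n ^+ K), m.
have Nx : normal_set N (n ^+ K).
  by rewrite -coset_eq1 cosetX; move/coset_eq1: Nn => ->; rewrite expg1n.
have Nmv : normal_set N (m ^ v) by apply: normal_conj.
split=> // c E; have Uu := cyclic_mod_id u.
have cuE x : normal_set N x -> coset N (u * n ^+ K * x) = coset N u.
  move=> /coset_eq1 x1; rewrite (cosetM N _ x) cosetM x1.
  by move/coset_eq1: Nx => ->; rewrite !mulg1.
(* In [F / N] both elements become [u], so the conjugator commutes with it. *)
have cu : commute_mod c u.
  move: (coset_derived E); rewrite cosetJ !cuE //.
  by move=> /esym/conjg_fixP/commgP/commute_sym/coset_commute.
have flowE g b x : normal_set N x -> gflow (ind U g) b (u * n ^+ K * x) =
    (gflow (ind U g) b u + gflow (ind U g) b x + K%:R * gflow (ind U g) b n)%R.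
  move=> Nx'; have inv := ind_linv g sU.
  rewrite (gflow_linvM _ _ inv); last by apply: UM => //; apply: NU.
  rewrite (gflow_linvM _ _ inv) // (gflow_linvX _ _ inv); last exact: NU.
  by rewrite GRing.addrAC.
have flow2 g b : (gflow (ind U g) b u + gflow (ind U g) b (m ^ v)%g
      + K%:R * gflow (ind U g) b n =
    gflow (ind U (c * g)%g) b u + gflow (ind U (c * g)%g) b m
      + K%:R * gflow (ind U (c * g)%g) b n)%R.
  rewrite -!flowE // -gflow_ind_conj //.
  - apply: gflow_coset E => y k Ny; exact/(ind_linv _ sU)/NU.
  - by move=> y; apply: cyclic_mod_conj.
  - by apply: (UM); [apply: UM => //|]; apply: NU.
have bound g b x : (absz (gflow (ind U g) b x) <= 2 * size (free_word x))%N.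
  by apply: flow_bound => h; apply: absz_ind.
have Uc : U c.
  apply: rig; split=> // g b; apply: (@gflow_digits K L _ _ _ _ (ltnSn _)) (flow2 g b).
    by rewrite (leq_trans (absz_add (bound _ _ _) (bound _ _ _))) // /L -addnA leq_add2l leq_addl.
  by rewrite (leq_trans (absz_add (bound _ _ _) (bound _ _ _))) // /L leq_addr.
(* Translation by an element of [U] fixes every vertex, so the low digits equate the flows of
   [m ^ v] and [m]. *)
apply: neq; have := flow2 g0 b0; rewrite !(eq_gflow _ _ (eq_ind _ sU Uc)).
move=> /GRing.addIr/GRing.addrI <-; apply: gflow_ind_conj => //.
- by move=> y; apply: cyclic_mod_conj.
- exact: NU.
Qed.

End Commuting.

Lemma conjugate_of_power u v n m : cyclic_mod u v -> normal_set N n -> normal_set N m ->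
  exists c, coset D (u * n * m ^ v) = coset D ((u * n * m) ^ c).
Proof.
(* Quantifying over all [n] and [m] makes [R] a subgroup, as conjugates of [m] may be substituted
   for it. *)
pose R : set F := [set g | forall n m, normal_set N n -> normal_set N m ->
  exists c, coset D (u * n * m ^ g) = coset D ((u * n * m) ^ c)].
suff UR : forall x, cyclic_mod u x -> R x by move=> /UR; apply.
apply: cyclic_mod_min.
- split=> [k l _ _|x y Rx Ry k l Nk Nl|x Rx k l Nk Nl].
  + by exists 1; rewrite !conjg1.
  + have [c E] := Rx k l Nk Nl; have [c' E'] := Ry k (l ^ x) Nk (normal_conj _ Nl).
    by exists (c * c'); rewrite !conjgM E' cosetJ E -cosetJ.
  + have [c] := Rx k (l ^ x^-1) Nk (normal_conj _ Nl).
    rewrite -conjgM mulVg conjg1 => E; exists c^-1.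
    by rewrite cosetJ E -cosetJ -conjgM mulgV conjg1.
- move=> x Nx k l _ Nl; exists 1.
  rewrite conjg1 (cosetM D _ (l ^ x)) (cosetM D _ l); congr (_ * _).
  by rewrite /conjg cosetM (coset_derivedC Nl Nx) -cosetM mulKg.
(* Conjugating by [l^-1] brings [l] to the front, and moving it past [u] turns it into [l ^ u]. *)
move=> k l Nk Nl; exists l^-1.
have -> : (u * k * l) ^ l^-1 = u * (l ^ u * k).
  by rewrite conjgE invgK mulgK (mulgA l) (conjgC l u) -(mulgA u).
rewrite -mulgA !(cosetM D u); congr (_ * _).
by apply: coset_derivedC => //; apply: normal_conj.
Qed.

End Certificates.

(** * The case of a trivial kernel *)

Section TrivialKernel.
Variables (X : choiceType) (N : normal_subgroup (free_group X)).
Local Notation F := (free_group X).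
Local Notation ev := (eval (@free_gen X)).
Hypothesis N_trivial : forall x, normal_set N x -> x = 1.
Implicit Types u v : F.

Lemma coset_trivial (x y : F) : coset N x = coset N y -> x = y.
Proof. by move=> /cosetP/N_trivial/mulg1_eq; rewrite invgK. Qed.

(** No later step leaves the base vertex, and the last step, the only one to return there, is not
    the first edge backwards: that edge is crossed once. *)
Lemma flow_simple_cycle (V : set F) t0 t : subgroup V -> simple_cycle V (t0 :: t) ->
  flow (ind V 1) t0 (t0 :: t) = 1%R.
Proof.
move=> [V1 _ _] [_ _ simple last_t] /=.
rewrite eqxx eq_sym (negbTE (inv_letter_neq t0)) ind1 ?invg1 ?mulg1 //.
rewrite flow_avoids ?GRing.mul1r ?GRing.mul0r ?GRing.subr0 ?GRing.addr0 // => i it.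
have out j : (0 < j < (size t).+1)%N -> ind V 1 (ev (take j (t0 :: t))) = 0%R.
  move=> /andP[j0 jt]; apply: ind0; rewrite invg1 mulg1 => Vj.
  by case: (simple 0%N j); rewrite ?j0 // take0 eval_nil invg1 mulg1.
rewrite -!eval_cons; split=> [_|tE]; first exact: (out i.+1).
move: it; rewrite leq_eqVlt => /predU1P[it|it]; last exact: (out i.+2).
have := last_t _ t0; rewrite [size (t0 :: t)]/= -it => /(_ isT).
by rewrite /= (last_nth t0) -it /= tE eqxx.
Qed.

(* If v = u ^ k, a coordinate of the first homology of the graph of cosets of
   <u> that does not vanish at u gives |k| <= |flow v| <= 2 |v|. *)
Lemma free_power_bound u v b : cyclic_mod N u v -> (2 * size (free_word v) <= b)%N ->
  exists l, (l <= 2 * b)%N /\ v * u ^+ (b + l) = u ^+ (2 * b).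
Proof.
move=> Uv vb; case: (pselect (u = 1)) => [u1|u1].
  case: (Uv) => i [j]; rewrite u1 !expg1n mulg1 => /coset_trivial ->.
  by exists 0%N; rewrite !expg1n mulg1.
have sN := normal_subgroupP N; have sU := cyclic_mod_subgroup N u.
have nNu : exists x, cyclic_mod N u x /\ ~ normal_set N x.
  by exists u; split; [exact: cyclic_mod_id|move/N_trivial].
have [f [t [_ cyc]]] := shortest_cycle sN sU nNu.
case: t cyc => [[]//|t0 t cyc].
have := flow_simple_cycle (conj_subgroup f sU) cyc; set y := ev (t0 :: t) ^ f^-1.
have Uy : cyclic_mod N u y by case: cyc.
set A := ind (cyclic_mod N u) f; have invA : left_invariant (cyclic_mod N u) A by apply: ind_linv.
rewrite -gflow_eval (_ : gflow _ _ _ = gflow A t0 y); last first.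
  rewrite gflow_conj => [|k]; last exact: invA.
  apply: eq_gflow => k; rewrite /A /ind; congr (if _ then _ else _); apply: asbool_equiv_eq.
  by rewrite /conj_set /= invg1 mulg1 /conjg !invgK mulgA.
have powE x i j : coset N (x * u ^+ i) = coset N (u ^+ j) -> cyclic_mod N u x ->
    (gflow A t0 x + i%:R * gflow A t0 u = j%:R * gflow A t0 u)%R.
  move=> /coset_trivial E Ux; have Uu := cyclic_mod_id N u.
  by rewrite -!(gflow_linvX _ _ invA) // -E (gflow_linvM _ _ invA).
case: (Uy) => i1 [j1 /powE/(_ Uy) yE] y1; case: (Uv) => i [j vE].
have := powE _ _ _ vE Uv; rewrite {}y1 in yE.
have : (absz (gflow A t0 v) <= b)%N.
  by apply: leq_trans vb; apply: flow_bound => g; apply: absz_ind.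
rewrite !natz in yE *; move: (gflow A t0 u) (gflow A t0 v) yE => du dv yE dvb E.
(* The cycle gives an element of [<u>] with flow 1, so the flow of [u] is non-zero. *)
have du0 : (0 < absz du)%N by rewrite lt0n absz_eq0; apply/eqP => du0; move: yE; rewrite du0; lia.
have [jb ib] : (j <= i + b /\ i <= j + b)%N by split; nia.
(* With [v = u^(j - i)] and |j - i| at most [b], the number [b - (j - i)] lies between 0 and
   [2 * b]. *)
exists (b + i - j)%N; split; first by lia.
apply: (@mulIg _ (u ^+ i)); rewrite -mulgA -!expgnDr addnC expgnDr mulgA.
by rewrite (coset_trivial vE) -expgnDr; congr (_ ^+ _); lia.
Qed.

End TrivialKernel.

(** * The decision procedure *)

Lemma cyclic_mod_intexp (X : choiceType) (N : normal_subgroup (free_group X))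
    (u v : free_group X) :
  (exists k : int, coset N v = intexp (coset N u) k) <-> cyclic_mod N u v.
Proof.
split=> [[[k|k] E]|[i [j]]].
- by exists 0%N, k; rewrite mulg1 E cosetX.
- by exists k.+1, 0%N; rewrite cosetM E cosetX mulVg.
rewrite cosetM !cosetX => E; have [ij|ji] := leqP i j.
  exists (Posz (j - i)); apply: (@mulIg _ (coset N u ^+ i)).
  by rewrite /= -expgnDr subnK.
exists (Negz (i - j).-1); rewrite /= prednK ?subn_gt0 //.
apply: (@mulIg _ (coset N u ^+ i)); rewrite E -[in X in _ * X](subnK (ltnW ji)).
by rewrite expgnDr mulgA mulVg mul1g.
Qed.

Section Decision.
Variables (X : finType) (N : normal_subgroup (free_group X)).
Hypothesis rank_ge2 : (2 <= #|X|)%N.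
Local Notation F := (free_group X).
Local Notation ev := (eval (@free_gen X)).
Local Notation D := (derived N).
Local Notation wcode := (@word_code X).
Let X_gt0 : (0 < #|X|)%N := ltnW rank_ge2.
Local Notation decode := (word_decode X_gt0).
Local Notation cat_code := (catc X_gt0).
Local Notation pow_code := (powc X_gt0).
Implicit Types u v w : word X.

(** Rank at least two provides at least four letters. *)
Lemma avoid_two_letters (b c : letter X) : exists a : letter X, a != b /\ a != c.
Proof.
have : (2 < #|{: letter X}|)%N.
  by rewrite card_prod card_bool (leq_trans _ (leq_mul rank_ge2 (leqnn 2))).
have -> : #|{: letter X}| = #|[set: letter X]%SET| by rewrite cardsT.
rewrite (cardsD1 b) (cardsD1 c) !inE => H.
have : (0 < #|[set: letter X]%SET :\ b :\ c|)%N.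
  by move: H; case: (c != b); rewrite /= ?add0n !add1n !ltnS // => /ltnW.
by case/card_gt0P=> a; rewrite !inE => /and3P[ac ab _]; exists a.
Qed.

Variables (enumN : nat -> nat) (conj_test : nat -> nat -> nat).
Hypothesis rec_enumN : forall k g, rec k g -> rec k (fun s => enumN (g s)).
Hypothesis enumNP : forall w, normal_set N (ev w) <-> exists i, enumN i = wcode w.
Hypothesis enumN_word : forall i, exists2 w, enumN i = wcode w & normal_set N (ev w).
Hypothesis rec_conj_test : forall k g1 g2, rec k g1 -> rec k g2 ->
  rec k (fun s => conj_test (g1 s) (g2 s)).
Hypothesis conj_testT : forall u v, (exists c, coset D (ev v) = coset D (ev u ^ c)) ->
  conj_test (wcode u) (wcode v) = 1%N.
Hypothesis conj_testF : forall u v, ~ (exists c, coset D (ev v) = coset D (ev u ^ c)) ->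
  conj_test (wcode u) (wcode v) = 0%N.

Lemma conj_test0 u v : conj_test (wcode u) (wcode v) = 0%N <->
  forall c, coset D (ev v) <> coset D (ev u ^ c).
Proof.
split=> [E c Ec|nc]; last by apply: conj_testF => -[c /nc].
by move: E; rewrite conj_testT //; exists c.
Qed.

(** The empty word has code 0, and only the identity is conjugate to the identity. *)
Definition triv_test m : nat := conj_test m 0.

Lemma triv_test0 w : triv_test (wcode w) = 0%N <-> coset D (ev w) <> 1.
Proof.
rewrite -[triv_test _]/(conj_test _ (wcode [::])) conj_test0 eval_nil; split=> [/(_ 1)|w1 c].
  by rewrite conjg1 => w1 /esym.
rewrite cosetJ => /esym E; apply: w1; apply: (@conjg_inj _ (coset D c)).
by rewrite E conj1g.
Qed.

Lemma triv_test1 w : (1 - triv_test (wcode w) = 0)%N <-> coset D (ev w) = 1.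
Proof.
case: (pselect (coset D (ev w) = 1)) => w1; last first.
  by have /triv_test0-> := w1.
rewrite -[triv_test _]/(conj_test _ (wcode [::])) conj_testT //.
by exists 1; rewrite conjg1 w1 eval_nil.
Qed.

Lemma rec_triv_test k g : rec k g -> rec k (fun s => triv_test (g s)).
Proof. by move=> rg; apply: rec_conj_test => //; apply: rec_const. Qed.

Ltac rec_tac := repeat first
  [ exact: rec_const | apply: rec_triv_test | apply: rec_mul | apply: rec_add | apply: rec_sub
  | apply: rec_dist | apply: rec_enumN | apply: rec_conj_test | apply: rec_catc
  | apply: rec_powc | exact: rec_nth ].

Lemma semidec_words (P : word X -> word X -> Prop) (Q : seq nat -> Prop) :
  (forall u v, P u v <-> Q [:: wcode u; wcode v]) -> semidec 2 Q ->
  semidec 2 (fun x => P (decode (nth 0 x 0)) (decode (nth 0 x 1))).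
Proof.
move=> PQ; apply: semidec_iff => -[|a [|b [|]]] // _ /=.
by have := PQ (decode a) (decode b); rewrite !word_decodeK => ->.
Qed.

Definition is_power_mod u v := cyclic_mod N (ev u) (ev v).

Lemma semidec_is_power_mod :
  semidec 2 (fun x => is_power_mod (decode (nth 0 x 0)) (decode (nth 0 x 1))).
Proof.
(* The searched [z] acts as an inverse of [u^j] modulo [N]: both [v u^i z] and [u^j z] must be
   enumerated. This avoids inverting words on codes. *)
pose test s := (dist (cat_code (nth 0 s 6) (cat_code (pow_code (nth 0 s 2) (nth 0 s 5)) (nth 0 s 4)))
                     (enumN (nth 0 s 0))
  + dist (cat_code (pow_code (nth 0 s 3) (nth 0 s 5)) (nth 0 s 4)) (enumN (nth 0 s 1)))%N.
have rtest : rec 7 test by rewrite /test; rec_tac.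
apply: semidec_words (semidec_ex (semidec_ex (semidec_ex (semidec_ex (semidec_ex (semidec_eq0 rtest)))))).
move=> u v; rewrite /test /=; split.
  case=> i [j E]; pose z := inv_word (wpow j u).
  have /enumNP[k kE] : normal_set N (ev (v ++ wpow i u ++ z)).
    apply/coset_eq1; rewrite !eval_cat eval_inv_word !eval_wpow mulgA cosetM E.
    by rewrite cosetV mulgV.
  have /enumNP[l lE] : normal_set N (ev (wpow j u ++ z)).
    by rewrite eval_cat eval_inv_word mulgV; case: (normal_subgroupP N).
  exists (wcode z), j, i, l, k; rewrite !powcE !catcE kE lE.
  by rewrite /dist !subnn.
case=> m [j [i [l [k /eqP]]]]; rewrite addn_eq0 -(word_decodeK X_gt0 m).
set z := decode m; rewrite !powcE !catcE => /andP[/eqP/dist_eq0 E1 /eqP/dist_eq0 E2].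
have /coset_eq1 N1 : normal_set N (ev (v ++ wpow i u ++ z)) by apply/enumNP; exists k.
have /coset_eq1 N2 : normal_set N (ev (wpow j u ++ z)) by apply/enumNP; exists l.
exists i, j; apply: (@mulIg _ (coset N (ev z))).
move: N1 N2; rewrite !eval_cat !eval_wpow mulgA !(cosetM N _ (ev z)) => -> ->.
by [].
Qed.

Lemma semidec_not_power_mod n0 : normal_set N n0 -> n0 <> 1 ->
  semidec 2 (fun x => ~ is_power_mod (decode (nth 0 x 0)) (decode (nth 0 x 1))).
Proof.
move=> Nn0 n0_neq1.
(* Entry 2 is a word [w] with [v w = m] in [N], so that [w v] is [m ^ v], again without inverting
   [v]. *)
pose test1 s := (dist (cat_code (nth 0 s 4) (nth 0 s 2)) (enumN (nth 0 s 1))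
  + conj_test (cat_code (nth 0 s 3) (cat_code (enumN (nth 0 s 0)) (cat_code (nth 0 s 4) (nth 0 s 2))))
              (cat_code (nth 0 s 3) (cat_code (enumN (nth 0 s 0)) (cat_code (nth 0 s 2) (nth 0 s 4)))))%N.
(* In [F / N'], [e] is an inverse of [v u] and [z] one of [n u v e]; the last term asks that [n] and
   [u v e] do not commute. *)
pose test2 s := ((1 - triv_test (cat_code (nth 0 s 4) (cat_code (nth 0 s 3) (nth 0 s 1))))
  + (1 - triv_test (cat_code (enumN (nth 0 s 0)) (cat_code (nth 0 s 3)
      (cat_code (nth 0 s 4) (cat_code (nth 0 s 1) (nth 0 s 2))))))
  + triv_test (cat_code (nth 0 s 3) (cat_code (nth 0 s 4)
      (cat_code (nth 0 s 1) (cat_code (enumN (nth 0 s 0)) (nth 0 s 2))))))%N.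
have r1 : rec 5 test1 by rewrite /test1; rec_tac.
have r2 : rec 5 test2 by rewrite /test2; rec_tac.
apply: (@semidec_words (fun u v => ~ is_power_mod u v) _ _ (semidec_or
  (semidec_ex (semidec_ex (semidec_ex (semidec_eq0 r1))))
  (semidec_ex (semidec_ex (semidec_ex (semidec_eq0 r2)))))).
move=> u v; rewrite /test1 /test2 /=; split=> [nUv|].
  case: (pselect (commute_mod N (ev v) (ev u))) => [vu|nvu]; [left|right].
    have [n [m [Nn Nm nconj]]] := nonconjugate Nn0 n0_neq1 avoid_two_letters vu nUv.
    pose w := inv_word v ++ free_word m.
    have vwE : ev (v ++ w) = m by rewrite !eval_cat eval_inv_word eval_free_word mulVKg.
    have /enumNP[i iE] : normal_set N (ev (free_word n)) by rewrite eval_free_word.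
    have /enumNP[j jE] : normal_set N (ev (v ++ w)) by rewrite vwE.
    exists (wcode w), j, i; rewrite iE jE !catcE /dist !subnn add0n; apply/conj_test0 => c.
    have -> : ev (u ++ free_word n ++ w ++ v) = ev u * n * m ^ ev v.
      rewrite !eval_cat eval_inv_word !eval_free_word.
      by rewrite /conjg !mulgA.
    have -> : ev (u ++ free_word n ++ v ++ w) = ev u * n * m; last exact: nconj.
    by rewrite 2!eval_cat vwE eval_free_word mulgA.
  pose v' := ev u * ev v * (ev v * ev u)^-1.
  have nNv' : ~ normal_set N v'.
    move=> /coset_eq1; rewrite /v' cosetM cosetV => /divg1_eq E; apply: nvu; exact/esym.
  have [m [Nm neq]] := noncommuting Nn0 n0_neq1 avoid_two_letters nNv'.
  have /enumNP[i iE] : normal_set N (ev (free_word m)) by rewrite eval_free_word.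
  pose e := inv_word (v ++ u); pose z := inv_word (free_word m ++ u ++ v ++ e).
  exists (wcode z), (wcode e), i; rewrite iE !catcE; apply/eqP; rewrite !addn_eq0.
  apply/andP; split; first apply/andP; first split.
  - apply/eqP/triv_test1; rewrite !eval_cat eval_inv_word eval_cat mulgA mulgV.
    exact: coset1.
  - apply/eqP/triv_test1; rewrite !catA eval_cat /z eval_inv_word -!catA mulgV.
    exact: coset1.
  apply/eqP/triv_test0 => E; apply: neq.
  have v'E : ev (u ++ v ++ e) = v' by rewrite !eval_cat eval_inv_word eval_cat mulgA.
  have zE : ev z = (m * v')^-1 by rewrite eval_inv_word eval_cat v'E eval_free_word.
  move: E; rewrite !catA 2!eval_cat zE -!catA v'E eval_free_word cosetM cosetV.
  by move/divg1_eq.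
move=> H Uv; case: H => -[z [e [i /eqP]]].
  rewrite addn_eq0; have [n -> Nn] := enumN_word i; have [vw eE Nvw] := enumN_word e.
  rewrite -(word_decodeK X_gt0 z) eE; set w := decode z; rewrite !catcE.
  move=> /andP[/eqP/dist_eq0/word_code_inj vwE /eqP/conj_test0 nconj].
  move: Nvw; rewrite -vwE eval_cat => Nvw.
  have [c E] := conjugate_of_power Uv Nn Nvw; apply: (nconj c).
  move: E; rewrite !eval_cat /conjg !mulgA.
  by rewrite mulgVK.
rewrite !addn_eq0; have [n -> Nn] := enumN_word i.
rewrite -(word_decodeK X_gt0 z) -(word_decodeK X_gt0 e) !catcE.
set zw := decode z; set ew := decode e.
move=> /andP[/andP[/eqP/triv_test1 E1 /eqP/triv_test1 E2] /eqP/triv_test0]; apply.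
(* If [v] is in [<u>N] then [u v e] lies in [N], and so it commutes with [n] modulo [N']. *)
have Nc : normal_set N (ev (u ++ v ++ ew)).
  apply/coset_eq1; move: E1 => /(@coset_derived _ N _ 1).
  rewrite coset1 => <-; rewrite !eval_cat !mulgA !(cosetM N _ (ev ew)).
  by congr (_ * _); apply/esym/cyclic_mod_commute.
rewrite !catA 2!eval_cat -!catA cosetM coset_derivedC // -cosetM.
by rewrite -!eval_cat -!catA in E2 *.
Qed.

Lemma semidec_not_power_mod_free : (forall x, normal_set N x -> x = 1) ->
  semidec 2 (fun x => ~ is_power_mod (decode (nth 0 x 0)) (decode (nth 0 x 1))).
Proof.
move=> N1; have D1 x : coset D x = 1 <-> x = 1.
  split=> [/(@coset_derived _ N _ 1)/(coset_trivial N1)//|->]; exact: coset1.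
(* Here [b] is twice the code of [v], hence at least twice its length, and [z] is to invert
   [u^(2b)]. A factor vanishes when [v u^(b + l) z = 1], so a non-zero product rules out every [l]
   up to [2b]. *)
pose factor s := (1 - triv_test (cat_code (nth 0 s 3)
  (cat_code (pow_code (2 * nth 0 s 3 + nth 0 s 0) (nth 0 s 2)) (nth 0 s 1))))%N.
pose test s := ((1 - triv_test (cat_code (pow_code (2 * (2 * nth 0 s 2)) (nth 0 s 1)) (nth 0 s 0)))
  + (1 - \prod_(l < (2 * (2 * nth 0 s 2)).+1) factor (val l :: s)))%N.
have rf : rec 4 factor by rewrite /factor; rec_tac.
have rtest : rec 3 test.
  apply: rec_add; first by rec_tac.
  apply: rec_sub; first exact: rec_const.
  by apply: rec_bprod rf _; apply: recS; rec_tac.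
apply: (@semidec_words (fun u v => ~ is_power_mod u v) _ _ (semidec_ex (semidec_eq0 rtest))) => u v.
rewrite /test /=; set b := (2 * wcode v)%N.
have vb : (2 * size (free_word (ev v)) <= b)%N.
  rewrite leq_mul2l /=; apply: leq_trans (size_le_word_code v).
  rewrite eval_free_gen; elim: v {b} => //= a v IH.
  by case: (mul_word v [::]) IH => //= c s; case: ifP => //= _ /ltnW; lia.
have factorE z l : triv_test (cat_code (wcode v) (cat_code (pow_code (b + l) (wcode u)) (wcode z))) <> 0%N
   <-> ev v * ev u ^+ (b + l) * ev z = 1.
  rewrite powcE !catcE -D1; split=> [t0|E /triv_test0].
    apply: contrapT => E; apply: t0; apply/triv_test0.
    by rewrite !eval_cat eval_wpow mulgA.
  by rewrite !eval_cat eval_wpow mulgA.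
split=> [nUv|[z /eqP]].
  pose z := inv_word (wpow (2 * b) u); exists (wcode z); apply/eqP; rewrite addn_eq0.
  apply/andP; split.
    by rewrite powcE catcE; apply/eqP/triv_test1/D1; rewrite eval_cat eval_inv_word mulgV.
  rewrite subn_eq0 lt0n; apply/eqP => /prod_eq0[l]; rewrite /factor /= => f0.
  have /factorE : triv_test (cat_code (wcode v) (cat_code (pow_code (b + l) (wcode u)) (wcode z))) <> 0%N.
    by move=> t0; rewrite t0 in f0.
  rewrite eval_inv_word eval_wpow => /divg1_eq E; apply: nUv.
  by exists (b + l)%N, (2 * b)%N; rewrite E.
rewrite addn_eq0 -(word_decodeK X_gt0 z); set zw := decode z.
move=> /andP[/eqP]; rewrite powcE catcE => /triv_test1/D1; rewrite eval_cat eval_wpow => zE.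
rewrite subn_eq0 lt0n => /eqP nprod Uv; apply: nprod.
have [l [lb E]] := free_power_bound N1 Uv vb.
apply/prod_eq0; have lb' : (l < (2 * b).+1)%N by rewrite ltnS.
exists (Ordinal lb'); rewrite /factor /=; apply/eqP; rewrite subn_eq0 lt0n; apply/eqP.
by apply/factorE; rewrite E.
Qed.

End Decision.

Theorem theorem6p15 (X : finType) (rank_ge2 : (2 <= #|X|)%N)
    (N : normal_subgroup (free_group X)) (N_re : rec_enumerable_subset N) :
  conjugacy_problem_decidable (quotient_gen (derived N)) ->
  power_problem_decidable (quotient_gen N).
Proof.
case=> f [rf fP]; have [N1 _ _] := normal_subgroupP N.
have [enumN [renum enumNP]] : exists g : nat -> nat,
    rec 1 (fun s => g (nth 0 s 0)) /\
    [set word_code w | w in [set w | normal_set N (eval (@free_gen X) w)]] = range g.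
  case: N_re => [N0|[g [rg gE]]].
    have : set0 (word_code ([::] : word X)) by rewrite -N0; exists [::]; rewrite //= eval_nil.
    by [].
  exists (fun i => g [tuple i]); split=> //.
  rewrite /rec (_ : (fun x => _) = g) //; apply: funext => x; congr (g _).
  by apply: eq_from_tnth => i; rewrite ord1 (tnth_nth 0) /= (tnth_nth 0).
have renumN k h : rec k h -> rec k (fun s => enumN (h s)) by apply: rec_app1.
have NE w : normal_set N (eval (@free_gen X) w) <-> exists i, enumN i = word_code w.
  split=> [Nw|[i iE]].
    have : range enumN (word_code w) by rewrite -enumNP; exists w.
    by case=> i _ iE; exists i.
  have : range enumN (word_code w) by exists i.
  by rewrite -enumNP => -[w' Nw' /word_code_inj <-].
have Nword i : exists2 w, enumN i = word_code w & normal_set N (eval (@free_gen X) w).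
  have : range enumN (enumN i) by exists i.
  by rewrite -enumNP => -[w Nw <-]; exists w.
pose conj_test a b := f [tuple a; b].
have rconj k g1 g2 : rec k g1 -> rec k g2 -> rec k (fun s => conj_test (g1 s) (g2 s)).
  apply: rec_app2; rewrite /rec (_ : (fun x => _) = f) //; apply: funext => x.
  congr (f _); apply: eq_from_tnth => i; rewrite !(tnth_nth 0).
  by case: i => [[|[|]]].
have conjE u v : (exists g, eval (quotient_gen (derived N)) v = eval (quotient_gen (derived N)) u ^ g) <->
    exists c, coset (derived N) (eval (@free_gen X) v) = coset (derived N) (eval (@free_gen X) u ^ c).
  rewrite !eval_quotient_gen; split=> [[g]|[c]].
    by have [c <-] := coset_surj g; rewrite -cosetJ; exists c.
  by rewrite cosetJ; exists (coset (derived N) c).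
have conjT u v := (fP u v).1 \o (conjE u v).2.
have conjF u v : ~ (exists c, coset (derived N) (eval (@free_gen X) v) =
    coset (derived N) (eval (@free_gen X) u ^ c)) -> conj_test (word_code u) (word_code v) = 0.
  by move=> nc; apply: (fP u v).2 => /conjE.
have powE u v : is_power_mod N u v <->
    exists k, eval (quotient_gen N) v = intexp (eval (quotient_gen N) u) k.
  by rewrite !eval_quotient_gen; split=> /cyclic_mod_intexp.
apply: (@decidable_rel_semidec X (ltnW rank_ge2) (fun u v =>
  exists k, eval (quotient_gen N) v = intexp (eval (quotient_gen N) u) k)).
  exact: semidec_iff (fun x _ => powE _ _) (semidec_is_power_mod rank_ge2 renumN NE).
apply: semidec_iff (fun x _ => not_iff_compat (powE _ _)) _.
(* The algorithm does not decide which case holds; a decision function exists in either. *)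
case: (pselect (exists n, normal_set N n /\ n <> 1)) => [[n [Nn n1]]|nex].
  exact: (semidec_not_power_mod rank_ge2 renumN NE Nword rconj conjT conjF Nn n1).
apply: (semidec_not_power_mod_free rank_ge2 rconj conjT conjF).
by move=> x Nx; apply: contrapT => x1; apply: nex; exists x.
Qed.
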